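(* Let $A\in\mathscr{R}$ be fixed and let $r>0$. Let $\{\mathbf{X}^{(i)}, i\in\mathbb{N}\}$ be identically distributed copies of a random vector $\mathbf{X}$ with distribution $F$ supported on $[0,\infty)^d$, such that the sequences $\{\mathbf{X}^{(i)}, i\in\mathbb{N}\}$ and $\{\tau_i, i\in\mathbb{N}\}$ are independent of each other. Suppose that $F\in(\mathcal{C}\cap\mathcal{P_D})_A$, and that there exist $q_1,q_2$ with $0<q_1<J_{F_A}^-\le J_{F_A}^+<q_2<\infty$ such that $$\sum_{i=1}^{\infty}\left(\max\left\{\mathbf{E}\left[e^{-q_1r\tau_i}\right],\ \mathbf{E}\left[e^{-q_2r\tau_i}\right]\right\}\right)^{1/q}<\infty,$$ where $q=\mathbf{1}_{\{0<J_{F_A}^+<1\}}+q_2\,\mathbf{1}_{\{J_{F_A}^+\ge1\}}$. Suppose further that $\{\mathbf{X}^{(i)}, i\in\mathbb{N}\}$ is quasi asymptotically independent on $A$ ($QAI_A$). Then, as $x\to\infty$, $$\mathbf{P}\left(\mathbf{D}(\infty)\in xA\right)\sim\int_0^\infty\mathbf{P}\left(\mathbf{X}e^{-rs}\in xA\right)m(ds).$$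
   Context: Fix $d\in\mathbb{N}$. The relation $f(x)\sim g(x)$ means $f(x)/g(x)\to1$ as $x\to\infty$; all limits inferior/superior below are as $x\to\infty$ unless indicated. A set $B\subset\mathbb{R}^d$ is increasing if $\mathbf{b}+\mathbf{z}\in B$ for all $\mathbf{b}\in B$, $\mathbf{z}\in[0,\infty)^d$. $\mathscr{R}$ is the family of all $A\subset\mathbb{R}^d$ that are open, increasing, with $A^c$ convex and $\mathbf{0}\notin\overline{A}$. Claim vectors: each $\mathbf{X}^{(i)}$ takes values in $[0,\infty)^d$; some components may be zero, but not all components are zero. Counting process: $0\le\tau_1\le\tau_2\le\dots$ are random claim arrival times, $N(t)=\sup\{i\in\mathbb{N}:\tau_i\le t\}$ ($\sup\emptyset=0$), $N(\infty)=\infty$, and $m(t)=\mathbf{E}[N(t)]=\sum_{i\ge1}\mathbf{P}(\tau_i\le t)$ is assumed finite for every fixed $t\ge0$; $m(ds)$ denotes the corresponding mean measure $\sum_i\mathbf{P}(\tau_i\in ds)$ on $[0,\infty)$. Discounted aggregate claims: $\mathbf{D}(\infty)=\sum_{i=1}^{\infty}\mathbf{X}^{(i)}e^{-r\tau_i}$. For $A\in\mathscr{R}$ and a random vector $\mathbf{Z}$ in $[0,\infty)^d$ with distribution $G$, put $Z_A=\sup\{u>0:\mathbf{Z}\in uA\}$ ($\sup\emptyset=0$) and let $G_A$ be its distribution; then $\overline{G_A}(x)=1-G_A(x)=\mathbf{P}(\mathbf{Z}\in xA)$ for $x>0$. $G\in(\mathcal{C}\cap\mathcal{P_D})_A$ means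 $G_A\in\mathcal{C}\cap\mathcal{P_D}$, where, for a one-dimensional distribution $V$ with $\overline V(x)=1-V(x)>0$ for all $x$: $V\in\mathcal{C}$ (consistently varying) if $\lim_{b\uparrow1}\limsup\overline V(bx)/\overline V(x)=1$; $V\in\mathcal{P_D}$ (positively decreasing) if $\limsup\overline V(vx)/\overline V(x)<1$ for any (equivalently some) $v>1$. Matuszewska indices of $V$: $J_V^+=-\lim_{v\to\infty}\log\overline V_*(v)/\log v$ and $J_V^-=-\lim_{v\to\infty}\log\overline V^*(v)/\log v$, where $\overline V_*(v)=\liminf\overline V(vx)/\overline V(x)$ and $\overline V^*(v)=\limsup\overline V(vx)/\overline V(x)$. $QAI_A$: nonnegative random variables $\{Z_i\}$ with distributions $\{G_i\}$ are quasi asymptotically independent ($QAI$) if $\lim_{x\to\infty}\mathbf{P}(Z_i>x,Z_j>x)/(\overline{G_i}(x)+\overline{G_j}(x))=0$ for all $i\ne j$. Random vectors $\{\mathbf{Z}^{(i)}\}$ in $[0,\infty)^d$ are $QAI_A$ if the random variables $Z_A^{(i)}=\sup\{u>0:\mathbf{Z}^{(i)}\in uA\}$ are $QAI$. *)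

(* Defs.v *)
From HB Require Import structures.
From mathcomp Require Import all_boot all_order all_algebra.
From mathcomp Require Import all_classical all_reals all_analysis.

Set Implicit Arguments.
Unset Strict Implicit.
Unset Printing Implicit Defensive.

Import Order.TTheory GRing.Theory Num.Theory.
Import numFieldNormedType.Exports.

Local Open Scope classical_set_scope.
Local Open Scope ring_scope.

(* R^d with its Borel sigma-algebra; convertible to 'rV[R]_d. *)
Notation borel_rV R d := (g_sigma_algebraType (@open 'rV[R]_d)).

Section sets.
Context (R : realType) (d : nat).
Implicit Types (A B : set 'rV[R]_d) (z : 'rV[R]_d).

Definition nonneg_vec z := forall j, 0 <= z 0 j.

Definition increasing_set B := forall b z, B b -> nonneg_vec z -> B (b + z).

Definition ruin_family A :=
  [/\ open A,
      increasing_set A,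
      convex_set (~` A : set (convex_lmodType 'rV[R]_d)) &
      ~ closure A 0].

Definition dilate (u : R) A : set 'rV[R]_d := [set u *: a | a in A].

(* `sup` of the empty set is 0. If [ruin_family A] then the set below is
   bounded above, because 0 is not in the closure of A. *)
Definition scale_radius A z : R := sup [set u | 0 < u /\ dilate u A z].

(* Membership in B of a vector with components in the extended reals. The
   components of an infinite series of nonnegative vectors may be +oo; for an
   increasing B and finite components this is plain membership, see
   [ext_mem_fin]. *)
Definition ext_mem B (D : 'I_d -> \bar R) :=
  exists2 y, B y & forall j, ((y 0 j)%:E <= D j)%E.

Lemma ext_mem_fin B z : increasing_set B ->
  ext_mem B (fun j => (z 0 j)%:E) <-> B z.
Proof.
move=> incB; split=> [[y By yz]|Bz]; last by exists z.
rewrite -(subrK y z) addrC; apply: incB => // j.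
by rewrite !mxE subr_ge0 -lee_fin.
Qed.

End sets.

Section tails.
Context (R : realType).
(* V is a distribution function on the real line. *)
Implicit Types V : R -> R.
Local Open Scope ereal_scope.

Definition tail V (x : R) : R := (1 - V x)%R.

Definition upper_tail V (v : R) : \bar R :=
  limf_esup (fun x : R => (tail V (v * x) / tail V x)%:E) (pinfty_nbhs R).

Definition lower_tail V (v : R) : \bar R :=
  limf_einf (fun x : R => (tail V (v * x) / tail V x)%:E) (pinfty_nbhs R).

Definition consistently_varying V :=
  (forall x, (0 < tail V x)%R) /\ upper_tail V b @[b --> 1%R^'-] --> 1.

Definition positively_decreasing V :=
  (forall x, (0 < tail V x)%R) /\ forall v : R, (1 < v)%R -> upper_tail V v < 1.

Definition upper_matuszewska V : \bar R :=
  - lim ((lne (lower_tail V v) * ((ln v)^-1)%:E) @[v --> +oo%R]).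

Definition lower_matuszewska V : \bar R :=
  - lim ((lne (upper_tail V v) * ((ln v)^-1)%:E) @[v --> +oo%R]).

End tails.

Section random.
Context (R : realType) (dOmega : measure_display).
Context (Omega : measurableType dOmega) (P : probability Omega R).

Definition distr_fun (Y : Omega -> R) (x : R) : R :=
  fine (P [set w | Y w <= x]).

Definition quasi_asymp_indep (Z : nat -> Omega -> R) :=
  forall i j, i != j ->
    fine (P [set w | x < Z i w /\ x < Z j w]) /
      (tail (distr_fun (Z i)) x + tail (distr_fun (Z j)) x)
      @[x --> +oo] --> (0 : R).

Definition sigma_seq d' (T : measurableType d') (Y : nat -> Omega -> T) :
    set (set Omega) :=
  <<s \bigcup_i preimage_set_system setT (Y i) measurable >>.

Definition indep_seq d1 (T1 : measurableType d1) d2 (T2 : measurableType d2)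
    (Y : nat -> Omega -> T1) (Z : nat -> Omega -> T2) :=
  forall E F, sigma_seq Y E -> sigma_seq Z F ->
    P (E `&` F) = (P E * P F)%E.

(* Sequences are indexed from 0: [tau i] is the arrival time of claim i + 1. *)

Definition claim_number (tau : nat -> Omega -> R) (t : R) (w : Omega) : \bar R :=
  ereal_sup ([set 0%E] `|` [set i.+1%:R%:E | i in [set i | tau i w <= t]]).

Definition mean_number (tau : nat -> Omega -> R) (t : R) : \bar R :=
  (\int[P]_w claim_number tau t w)%E.

Definition mean_measure (tau : nat -> {RV P >-> R}) :
    {measure set R -> \bar R} :=
  [the measure _ _ of mseries (fun i => distribution P (tau i)) 0].

Definition discounted_claims (d : nat) (r : R) (X : nat -> Omega -> 'rV[R]_d)
    (tau : nat -> Omega -> R) (w : Omega) (j : 'I_d) : \bar R :=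
  (\sum_(0 <= i <oo) (X i w 0 j * expR (- (r * tau i w)))%:E)%E.

End random.

(* Main.v *)
(** Put [Z i = scale_radius A (X i) * exp (- r tau i)]. Since [A] is increasing
    and the complement of [A] is convex, [scale_radius A] is monotone and
    subadditive on nonnegative vectors, so that
    [{some Z i > x}] is contained in [{D in xA}], which is contained in
    [{some partial sum of the Z i > x}], and the problem is one-dimensional.

    For finitely many terms, [Z i <= scale_radius A (X i)] and quasi asymptotic
    independence make the joint exceedances negligible: Bonferroni's inequality
    gives the lower bound, and for the upper bound a sum exceeding [x] either has
    one term exceeding [bx] with [b] close to [1], or two terms exceeding a
    multiple of [x]. Consistent variation then lets [b] tend to [1].

    For the remainder, let [V i = min (Z i / y, 1)]. If the tail sum exceeds [y]
    then the sum of the [V i] is at least [1], and Young's inequality with weights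
    [w i] of total mass at most [1] yields that the sum of
    [w i ^ (1 - p) * V i ^ p] is at least [1]. Markov's inequality applies with
    [E (V i ^ p) <= C * E (exp (- q1 r tau i)) * P (scale_radius A X > y)], where
    [p] above the upper index controls the truncated moment and [q1] below the
    lower index controls the discount; [w i] proportional to
    [E (exp (- q1 r tau i)) ^ (1 / p)] is the optimal choice and is summable by
    assumption. *)

Require Import Defs.
From mathcomp Require Import all_boot all_order all_algebra.
From mathcomp Require Import all_classical all_reals all_analysis.
From mathcomp Require Import measurable_realfun.
From mathcomp Require Import ring lra.

Set Implicit Arguments.
Unset Strict Implicit.
Unset Printing Implicit Defensive.

Import Order.TTheory GRing.Theory Num.Theory.
Import numFieldNormedType.Exports.

Local Open Scope classical_set_scope.
Local Open Scope ring_scope.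

(** * The gauge of a ruin set *)

Section geometry.
Context (R : realType) (d : nat).
Implicit Types (A : set 'rV[R]_d) (z : 'rV[R]_d) (u x : R).
Local Open Scope convex_scope.

Lemma dilateE A u z : u != 0 -> dilate u A z <-> A (u^-1 *: z).
Proof.
move=> u0; split=> [[a Aa <-]|Az]; first by rewrite scalerA mulVf ?scale1r.
by exists (u^-1 *: z) => //; rewrite scalerA mulfV ?scale1r.
Qed.

Lemma dilateZ A t u z : 0 < t -> 0 < u ->
  dilate u A (t *: z) <-> dilate (u / t) A z.
Proof.
move=> t0 u0.
rewrite !dilateE ?gt_eqF ?divr_gt0// scalerA.
by have -> : (u / t)^-1 = u^-1 * t by rewrite invf_div mulrC.
Qed.

Lemma open_dilate A u : open A -> u != 0 -> open (dilate u A).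
Proof.
move=> oA u0.
have -> : dilate u A = (fun z => u^-1 *: z) @^-1` A.
  by apply/seteqP; split=> z /dilateE; apply.
by apply: open_comp => // z _; exact: scaler_continuous.
Qed.

Lemma increasing_dilate A u : 0 < u -> increasing_set A ->
  increasing_set (dilate u A).
Proof.
move=> u0 incA b z /dilateE; rewrite gt_eqF// => /(_ isT) Ab z0.
apply/dilateE; first by rewrite gt_eqF.
by rewrite scalerDr; apply: incA => // j; rewrite mxE mulr_ge0// invr_ge0 ltW.
Qed.

Lemma norm_lower_bound A : ~ closure A 0 ->
  exists2 e : R, 0 < e & forall a, A a -> e <= `|a|.
Proof.
move=> clA.
have : ~ closure A 0 by [].
rewrite closureEnbhs /= => ncl.
have [B nB AB] : exists2 B, nbhs (0 : 'rV[R]_d) B & forall a, A a -> ~ B a.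
  apply: contrapT => H; apply: ncl => C B AC nB.
  apply: contrapT => AB; apply: H; exists B => // a Aa Ba.
  by apply: AB; exists a; split => //; exact: AC.
have /nbhs_ballP[e /= e0 eB] := nB.
exists e => // a Aa; rewrite leNgt; apply/negP => ae.
apply: (AB _ Aa); apply: eB.
by rewrite -ball_normE /ball_ /= sub0r normrN.
Qed.

Lemma scale_radius_ge0 A z : 0 <= scale_radius A z.
Proof.
have [E0|/set0P[u E]] := eqVneq [set u | 0 < u /\ dilate u A z] set0.
  by rewrite /scale_radius E0 sup0.
have [hs|hs] := pselect (has_sup [set u | 0 < u /\ dilate u A z]).
  apply: (@le_trans _ _ u); first by case: E => /ltW.
  by apply: ub_le_sup => //; case: hs.
by rewrite /scale_radius sup_out.
Qed.

Lemma has_ubound_scale_radius A z : ~ closure A 0 ->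
  has_ubound [set u | 0 < u /\ dilate u A z].
Proof.
move=> /norm_lower_bound[e e0 eA]; exists (`|z| / e) => u [u0 [a Aa <-]].
by rewrite normrZ (gtr0_norm u0) ler_pdivlMr// ler_wpM2l ?eA// ltW.
Qed.

(** The bound [0 <= x] matters because [sup] of the empty set is 0: only above 0 does exceeding [x]
    produce an actual dilation factor. *)
Lemma scale_radius_gtP A z x : ~ closure A 0 -> 0 <= x ->
  x < scale_radius A z <-> exists2 u, x < u & dilate u A z.
Proof.
move=> clA x0; split=> [xz|[u xu uA]].
  have [[v vE]|nE] := pselect ([set u | 0 < u /\ dilate u A z] !=set0).
    have [u [_ uA] xu] := sup_gt (ex_intro _ v vE) xz.
    by exists u.
  move: xz; rewrite /scale_radius sup_out ?ltNge ?x0// => -[[v vE] _].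
  by apply: nE; exists v.
apply: (lt_le_trans xu); apply: ub_le_sup.
  exact: has_ubound_scale_radius.
by split => //; exact: le_lt_trans xu.
Qed.

(** On nonnegative vectors an increasing [A] has dilates that shrink as the factor grows, so a
    factor above [x] gives membership in xA. Conversely, [A] is open, so membership in xA survives a
    slight increase of [x]; hence the strict inequality. *)
Lemma scale_radius_gt A z x : ruin_family A -> nonneg_vec z -> 0 < x ->
  x < scale_radius A z <-> dilate x A z.
Proof.
move=> [oA incA _ clA] z0 x0.
rewrite scale_radius_gtP ?(ltW x0)//; split=> [[u xu]|].
  have u0 : 0 < u by exact: lt_trans xu.
  rewrite !dilateE ?gt_eqF// => Au.
  have -> : x^-1 *: z = u^-1 *: z + (x^-1 - u^-1) *: z.
    by rewrite -scalerDl addrC subrK.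
  apply: incA => // j; rewrite mxE mulr_ge0// subr_ge0.
  by rewrite lef_pV2 ?ltW.
rewrite dilateE ?gt_eqF// => Ax.
have : \forall u \near x^'+, A (u^-1 *: z).
  have cvgf : (u^-1 *: z) @[u --> x^'+] --> x^-1 *: z.
    apply: cvg_at_right_filter; apply: cvgZr_tmp.
    by apply: cvgV; rewrite ?gt_eqF.
  by apply: cvgf; apply: open_nbhs_nbhs.
move=> H.
have [u [Au xu]] := filter_ex (filterI H (nbhs_right_gt x)).
by exists u => //; apply/dilateE => //; rewrite gt_eqF// (lt_trans x0 xu).
Qed.

(** The radius is lower semicontinuous: for [0 <= x] its superlevel set is the union of the open
    dilates uA with [x < u], and for negative [x] it is the whole space. *)
Lemma measurable_scale_radius A : ruin_family A ->
  measurable_fun [set: borel_rV R d] (scale_radius A : borel_rV R d -> R).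
Proof.
move=> [oA _ _ clA].
apply: (measurability _ (RGenOInfty.measurableE R)) => // _ [_ [x ->] <-].
rewrite setTI.
have [x0|x0] := leP 0 x.
  apply: sub_sigma_algebra.
  rewrite (_ : _ @^-1` _ = \bigcup_(u in [set u | x < u]) dilate u A).
    apply: bigcup_open => u xu; apply: open_dilate => //.
    by rewrite gt_eqF// (le_lt_trans x0 xu).
  apply/seteqP; split=> z /=; rewrite in_itv/= andbT.
    by move/(scale_radius_gtP _ clA x0) => [u xu uA]; exists u.
  by move=> [u xu uA]; apply/(scale_radius_gtP _ clA x0); exists u.
rewrite (_ : _ @^-1` _ = setT) //.
apply/seteqP; split=> // z _ /=; rewrite in_itv/= andbT.
exact: lt_le_trans (scale_radius_ge0 _ _).
Qed.

Lemma scale_radius0 A : ~ closure A 0 -> scale_radius A 0 = 0.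
Proof.
move=> clA; apply/eqP; rewrite eq_le scale_radius_ge0 andbT leNgt.
apply/negP => /(scale_radius_gtP _ clA (lexx 0))[u u0].
rewrite dilateE ?gt_eqF// scaler0 => A0.
by apply: clA; exact: subset_closure.
Qed.

Lemma nonneg_vecD z z' : nonneg_vec z -> nonneg_vec z' -> nonneg_vec (z + z').
Proof. by move=> z0 z'0 j; rewrite mxE addr_ge0. Qed.

Lemma nonneg_vecZ t z : 0 <= t -> nonneg_vec z -> nonneg_vec (t *: z).
Proof. by move=> t0 z0 j; rewrite mxE mulr_ge0. Qed.

Lemma nonneg_vec_sum n (f : nat -> 'rV[R]_d) : (forall i, nonneg_vec (f i)) ->
  nonneg_vec (\sum_(i < n) f i).
Proof. by move=> f0 j; rewrite summxE sumr_ge0 // => i _; exact: f0. Qed.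

Lemma scale_radiusZ A t z : ruin_family A -> 0 < t -> nonneg_vec z ->
  scale_radius A (t *: z) = t * scale_radius A z.
Proof.
move=> hA t0 z0; have tz0 := nonneg_vecZ (ltW t0) z0.
apply/eqP; rewrite eq_le !leNgt; apply/andP; split; apply/negP => lt.
  set u := scale_radius A z in lt.
  have v0 := mulr_ge0 (ltW t0) (scale_radius_ge0 A z).
  have [v uv vt] : exists2 v, t * u < v & v < scale_radius A (t *: z).
    by have [v1 v2] := midf_lt lt; eexists; [exact: v1|exact: v2].
  have vp := le_lt_trans v0 uv.
  move/(scale_radius_gt hA tz0 vp): vt.
  rewrite dilateZ// -scale_radius_gt ?divr_gt0//.
  by rewrite ltr_pdivrMr// mulrC ltNge (ltW uv).
set u := scale_radius A (t *: z) in lt.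
have [v uv vt] : exists2 v, u < v & v < t * scale_radius A z.
  by have [v1 v2] := midf_lt lt; eexists; [exact: v1|exact: v2].
have vp : 0 < v by exact: le_lt_trans (scale_radius_ge0 _ _) uv.
move: vt; rewrite mulrC -ltr_pdivrMr// scale_radius_gt ?divr_gt0//.
by rewrite -dilateZ// -scale_radius_gt// ltNge (ltW uv).
Qed.

(* If [z] is outside [uA] and [z'] is outside [u'A], then [(z + z')/(u + u')]
   is a convex combination of [z/u] and [z'/u'], hence outside [A]. *)
Lemma scale_radiusD A z z' : ruin_family A -> nonneg_vec z -> nonneg_vec z' ->
  scale_radius A (z + z') <= scale_radius A z + scale_radius A z'.
Proof.
move=> hA z0 z'0; rewrite leNgt; apply/negP => lt.
have [w w1 w2] : exists2 w, scale_radius A z + scale_radius A z' < w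
    & w < scale_radius A (z + z').
  by have [v1 v2] := midf_lt lt; eexists; [exact: v1|exact: v2].
(* Half of the gap is added to each radius, so that both bounds become strict and still add up to
   [w]. *)
pose e := (w - (scale_radius A z + scale_radius A z')) / 2.
have e0 : 0 < e by rewrite divr_gt0// subr_gt0.
set u := scale_radius A z + e; set u' := scale_radius A z' + e.
have u0 : 0 < u by rewrite ltr_wpDl ?scale_radius_ge0.
have u'0 : 0 < u' by rewrite ltr_wpDl ?scale_radius_ge0.
have uu' : w = u + u'.
  by rewrite /u /u' /e; lra.
have w0 : 0 < w by rewrite uu' addr_gt0.
move/(scale_radius_gt hA (nonneg_vecD z0 z'0) w0): w2.
apply: contraPP => _.
have nz : ~ dilate u A z.
  by rewrite -scale_radius_gt// => /lt_geF; rewrite /u lerDl (ltW e0).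
have nz' : ~ dilate u' A z'.
  by rewrite -scale_radius_gt// => /lt_geF; rewrite /u' lerDl (ltW e0).
have [_ _ cA _] := hA.
rewrite !dilateE ?gt_eqF// in nz nz' *.
have p0 : 0 <= u / w by rewrite divr_ge0// ltW.
have p1 : u / w <= 1 by rewrite ler_pdivrMr// mul1r uu' lerDl ltW.
have := cA (u^-1 *: z) (u'^-1 *: z') (Itv01 p0 p1).
rewrite !inE => /(_ nz nz').
suff -> : (u^-1 *: z : convex_lmodType _) <| Itv01 p0 p1 |> (u'^-1 *: z') =
  w^-1 *: (z + z') by [].
rewrite /conv/= /unstable.onem !scalerA scalerDr; congr (_ *: _ + _ *: _).
  by field; rewrite !gt_eqF.
by rewrite uu'; field; rewrite !gt_eqF//= -uu'.
Qed.

Lemma scale_radius_sum A n (f : nat -> 'rV[R]_d) : ruin_family A ->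
  (forall i, nonneg_vec (f i)) ->
  scale_radius A (\sum_(i < n) f i) <= \sum_(i < n) scale_radius A (f i).
Proof.
move=> hA f0; elim: n => [|n IH].
  by rewrite !big_ord0 scale_radius0//; case: hA.
rewrite !big_ord_recr /=.
apply: le_trans; first exact: scale_radiusD hA (nonneg_vec_sum _ f0) (f0 n).
by rewrite lerD2r.
Qed.

(** Openness leaves room below [z] in every coordinate at once. This slack lets an infinite sum be
    replaced by a partial sum. *)
Lemma dilate_shrink A x z : ruin_family A -> 0 < x -> dilate x A z ->
  exists2 e, 0 < e & dilate x A (z - const_mx e).
Proof.
move=> [oA _ _ _] x0 Az.
have : \forall e \near 0^'+, dilate x A (z - e *: const_mx 1).
  have cf : (z - e *: const_mx 1) @[e --> (0:R)^'+] --> z - (0:R) *: const_mx 1.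
    apply: cvg_at_right_filter; apply: cvgB; first exact: cvg_cst.
    by apply: cvgZr_tmp.
  rewrite scale0r subr0 in cf.
  have : nbhs z (dilate x A).
    by apply: open_nbhs_nbhs; split => //; apply: open_dilate; rewrite ?gt_eqF.
  by move/cf.
move=> H; have [e [Ae e0]] := filter_ex (filterI H (nbhs_right_gt 0)).
exists e => //.
suff <- : e *: const_mx 1 = const_mx e :> 'rV[R]_d by [].
by apply/rowP => j; rewrite !mxE mulr1.
Qed.

(** After lowering [y] by [e], every coordinate of the series, finite or not, lies strictly above
    it, so the partial sums pass it eventually, and simultaneously for the finitely many
    coordinates. *)
Lemma ext_mem_series A (f : nat -> 'rV[R]_d) x : ruin_family A -> 0 < x ->
  (forall i, nonneg_vec (f i)) ->
  ext_mem (dilate x A) (fun j => (\sum_(0 <= i <oo) (f i 0 j)%:E)%E) <->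
  exists n, dilate x A (\sum_(i < n) f i).
Proof.
move=> hA x0 f0.
have S_E n j : (\sum_(0 <= i < n) (f i 0 j)%:E)%E = ((\sum_(i < n) f i) 0 j)%:E.
  by rewrite big_mkord sumEFin summxE.
split=> [[y yA yD]|[n nA]]; last first.
  exists (\sum_(i < n) f i) => // j.
  rewrite -S_E; apply: nneseries_lim_ge => i _ _.
  by rewrite lee_fin; exact: f0.
have [e e0 yeA] := dilate_shrink hA x0 yA.
have : \forall n \near \oo, forall j : 'I_d,
    (((y - const_mx e) 0 j)%:E <= \sum_(0 <= i < n) (f i 0 j)%:E)%E.
  apply: filter_forall => j; apply: lte_lim.
  - by apply: ereal_nondecreasing_series => i _ _; rewrite lee_fin; exact: f0.
  - by apply: is_cvg_nneseries => i _ _; rewrite lee_fin; exact: f0.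
  - by apply: lt_le_trans (yD j); rewrite lte_fin !mxE ltrBlDr ltrDl.
move=> /filter_ex[n yn]; exists n.
rewrite -(subrK (y - const_mx e) (\sum_(i < n) f i)) addrC.
have [_ incA _ _] := hA.
apply: (increasing_dilate x0 incA) => // j.
by have := yn j; rewrite S_E lee_fin !mxE subr_ge0.
Qed.

(** * Measurability of the ruin event *)

Lemma rational_minorant (B : set 'rV[R]_d) z : open B -> B z ->
  exists2 q : 'rV[rat]_d, B (map_mx ratr q) & forall j, ratr (q 0 j) <= z 0 j.
Proof.
move=> oB Bz.
have /nbhs_ballP[e /= e0 eB] : nbhs z B by exact: open_nbhs_nbhs.
have /choice[q qP] : forall j, exists q, ratr q \in `]z 0 j - e, z 0 j[.
  by move=> j; apply: rat_in_itvoo; rewrite ltrBlDr ltrDl.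
exists (\row_j q j); last first.
  by move=> j; rewrite mxE; have := qP j; rewrite in_itv/= => /andP[_ /ltW].
apply: eB; split => // i j /=; rewrite ord1 !mxE /ball_ /=.
have := qP j; rewrite in_itv/= => /andP[h1 h2].
rewrite -ball_normE /ball_ /= gtr0_norm ?subr_gt0//.
by rewrite ltrBlDr addrC -ltrBlDr.
Qed.

(** Rational minorants turn the uncountable choice of [y] into a countable union of finite
    intersections of half-line events. *)
Lemma measurable_ext_mem d' (T : measurableType d') (B : set 'rV[R]_d)
    (D : T -> 'I_d -> \bar R) : open B -> increasing_set B ->
  (forall j, measurable_fun [set: T] (fun w => D w j)) ->
  measurable [set w | ext_mem B (D w)].
Proof.
move=> oB incB mD.
rewrite (_ : [set w | _] = \bigcup_(q : 'rV[rat]_d)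
    [set w | B (map_mx ratr q) /\ forall j, ((ratr (q 0 j))%:E <= D w j)%E]).
  apply: countable_bigcupT_measurable; first exact: countableP.
  move=> q; have [Bq|nBq] := pselect (B (map_mx ratr q)); last first.
    rewrite (_ : [set w | _] = set0)//.
    by apply/seteqP; split => w // -[].
  rewrite (_ : [set w | _] =
      \bigcap_(j in [set: 'I_d]) [set w | ((ratr (q 0 j))%:E <= D w j)%E]).
    apply: fin_bigcap_measurable => // j _.
    rewrite -[X in measurable X]setTI.
    exact: emeasurable_fun_c_infty.
  apply/seteqP; split => w /=; first by move=> [_ H] j _; exact: H.
  by move=> H; split => // j; exact: H.
apply/seteqP; split=> w /=.
  move=> [y By yD]; have [q Bq qy] := rational_minorant oB By.
  exists q => //; split => // j.
  by apply: le_trans (yD j); rewrite lee_fin.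
move=> [q _ [Bq qD]]; exists (map_mx ratr q) => // j.
by rewrite mxE; exact: qD.
Qed.

End geometry.

(** * Regular variation of tails *)

Lemma exists_expr_gt (R : realType) (v x : R) : 1 < v -> exists n, x < v ^+ n.
Proof.
move=> v1; have h0 : 0 < v - 1 by rewrite subr_gt0.
have bern n : n%:R * (v - 1) < v ^+ n.
  elim: n => [|n IH]; first by rewrite mul0r expr0.
  rewrite exprS -natr1 mulrDl mul1r.
  have v_n : 1 <= v ^+ n by rewrite exprn_ege1// ltW.
  nra.
exists (Num.bound (`|x| / (v - 1))); apply: le_lt_trans (bern _).
rewrite -ler_pdivrMr//; apply: ltW.
apply: le_lt_trans (archi_boundP _); last by rewrite divr_ge0// ltW.
by rewrite ler_pM2r ?invr_gt0// ler_norm.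
Qed.

Section limf.
Context (R : realType) (F : set_system R) (FF : ProperFilter F).
Implicit Types (f : R -> \bar R) (a : \bar R).
Local Open Scope ereal_scope.

Lemma limf_esup_lt f a : limf_esup f F < a -> \forall x \near F, f x < a.
Proof.
rewrite limf_esupE => /ereal_inf_lt[_ [V FV <-] sa].
apply: filterS FV => x Vx; apply: le_lt_trans sa.
by apply: ereal_sup_ubound; exists x.
Qed.

Lemma limf_einf_gt f a : a < limf_einf f F -> \forall x \near F, a < f x.
Proof.
rewrite limf_einfE => /ereal_sup_gt[_ [V FV <-] sa].
apply: filterS FV => x Vx; apply: lt_le_trans sa _.
by apply: ereal_inf_lbound; exists x.
Qed.

End limf.

(** * One-step tail inequalities from the Matuszewska indices *)

Section matuszewska.
Context (R : realType).
Implicit Types (V : R -> R) (g : R -> \bar R) (v p q x : R).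

(* If the limit did not exist, [lim] would return the junk value [0]. *)
Lemma cvg_of_lim_lt0 g : (lim (g v @[v --> +oo%R]) < 0)%E ->
  g v @[v --> +oo%R] --> lim (g v @[v --> +oo%R]).
Proof.
move=> l0; have [//|nc] := pselect (cvg (g v @[v --> +oo])).
by move: l0; rewrite (dvgP nc) ltxx.
Qed.

(** An index above [q > 0] forces the limit to be negative, hence genuine. Eventually the logarithm
    of [g v] is then below [- q * ln v], and it remains to exponentiate. *)
Lemma near_lower_index g q : 0 < q ->
  (q%:E < - lim ((lne (g v) * ((ln v)^-1)%:E) @[v --> +oo%R]))%E ->
  \forall v \near +oo, (g v < (v `^ (- q))%:E)%E.
Proof.
move=> q0; rewrite lteNr => lq.
set l := lim _ in lq.
have l0 : (l < 0)%E by apply: lt_trans lq _; rewrite lte_fin oppr_lt0.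
have cl := cvg_of_lim_lt0 l0.
have : \forall v \near +oo, (lne (g v) * ((ln v)^-1)%:E < (- q)%:E)%E.
  have : nbhs l (fun z => z < (- q)%:E)%E by exact: open_ereal_lt'.
  by move/cl.
move=> H; near=> v.
have v1 : 1 < v by near: v; exact: nbhs_pinfty_gt.
have lnv : 0 < ln v by rewrite ln_gt0.
have : (lne (g v) * ((ln v)^-1)%:E < (- q)%:E)%E by near: v.
have ev : v `^ (- q) = expR (- q * ln v).
  by rewrite /powR gt_eqF// (lt_trans _ v1).
rewrite ev; case: (g v) => [s| |] /=.
(* [lne] sends nonpositive reals to -oo, so these values form a separate case. *)
- case: ifPn => [s0 _|]; first by rewrite lte_fin (le_lt_trans s0)// expR_gt0.
  rewrite -ltNge => s0; rewrite -EFinM !lte_fin ltr_pdivrMr// => ls.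
  by rewrite -(lnK s0) ltr_expR.
- by rewrite gt0_mulye ?lte_fin ?invr_gt0.
- by rewrite ltNyr.
Unshelve. all: by end_near. Qed.

(** Positivity of the index excludes the default value of [lim], so that the limit really exists;
    the power bound follows by exponentiating. *)
Lemma near_upper_index g p :
  (0 < - lim ((lne (g v) * ((ln v)^-1)%:E) @[v --> +oo%R]) < p%:E)%E ->
  \forall v \near +oo, ((v `^ (- p))%:E < g v)%E.
Proof.
move=> /andP[]; rewrite oppe_gt0 => l0; rewrite lteNl => lp.
have cl := cvg_of_lim_lt0 l0.
have : \forall v \near +oo, ((- p)%:E < lne (g v) * ((ln v)^-1)%:E)%E.
  set l := lim _ in lp cl.
  have : nbhs l (fun z => (- p)%:E < z)%E by exact: open_ereal_gt'.
  by move/cl.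
move=> H; near=> v.
have v1 : 1 < v by near: v; exact: nbhs_pinfty_gt.
have lnv : 0 < ln v by rewrite ln_gt0.
have : ((- p)%:E < lne (g v) * ((ln v)^-1)%:E)%E by near: v.
have ev : v `^ (- p) = expR (- p * ln v).
  by rewrite /powR gt_eqF// (lt_trans _ v1).
rewrite ev; case: (g v) => [s| |] //=; rewrite ?ltry//.
- case: ifPn => [s0|]; first by rewrite gt0_mulNye ?lte_fin ?invr_gt0.
  rewrite -ltNge => s0; rewrite -EFinM !lte_fin ltr_pdivlMr// => ls.
  by rewrite -(lnK s0) ltr_expR.
- by rewrite gt0_mulNye ?lte_fin ?invr_gt0.
Unshelve. all: by end_near. Qed.

Lemma consistently_varying_near V (e : R) : consistently_varying V -> 0 < e ->
  exists2 b, 0 < b < 1 &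
    \forall x \near +oo, tail V (b * x) <= (1 + e) * tail V x.
Proof.
move=> [V0 cV] e0.
have : \forall b \near 1^'-, (upper_tail V b < (1 + e)%:E)%E.
  have : nbhs (1 : \bar R)%E (fun z => z < (1 + e)%:E)%E.
    by apply: open_ereal_lt'; rewrite lte_fin ltrDl.
  by move/cV.
move=> H.
near (1 : R)^'- => b; exists b.
  by apply/andP; split; near: b; [exact: nbhs_left_gt|exact: nbhs_left_lt].
have bV : (upper_tail V b < (1 + e)%:E)%E by near: b.
apply: filterS (limf_esup_lt _ bV) => x.
by rewrite lte_fin ltr_pdivrMr// => /ltW.
Unshelve. all: by end_near. Qed.

Lemma lower_matuszewska_near V q : (forall x, 0 < tail V x) -> 0 < q ->
  (q%:E < lower_matuszewska V)%E ->
  exists2 v, 1 < v &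
    \forall x \near +oo, tail V (v * x) <= v `^ (- q) * tail V x.
Proof.
move=> V0 q0 qJ; have H := near_lower_index q0 qJ.
have [v [vV v1]] := filter_ex (filterI H (nbhs_pinfty_gt (num_real 1))).
exists v => //; apply: filterS (limf_esup_lt _ vV) => x.
by rewrite lte_fin ltr_pdivrMr// => /ltW.
Qed.

(** [K] is the inverse of a number strictly between [v ^ (- p)] and the lower tail ratio at [v]. The
    inequality [K * v ^ (- p) < 1] is the contraction that later controls truncated moments. *)
Lemma upper_matuszewska_near V p : (forall x, 0 < tail V x) ->
  (0 < upper_matuszewska V < p%:E)%E ->
  exists v K, [/\ 1 < v, 0 < K, K * v `^ (- p) < 1 &
    \forall x \near +oo, tail V x <= K * tail V (v * x)].
Proof.
move=> V0 pJ; have H := near_upper_index pJ.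
have [v [vV v1]] := filter_ex (filterI H (nbhs_pinfty_gt (num_real 1))).
have a0 : 0 < v `^ (- p) by rewrite powR_gt0// (lt_trans _ v1).
have [k [k1 k2]] : exists k, v `^ (- p) < k /\ (k%:E < lower_tail V v)%E.
  move: vV; case: (lower_tail V v) => [s| |] //; last first.
    by move=> _; exists (v `^ (- p) + 1); rewrite ltrDl ltry.
  rewrite lte_fin => lt; have [h1 h2] := midf_lt lt.
  by eexists; split; first exact: h1.
have k0 := lt_trans a0 k1.
exists v, k^-1; split; rewrite ?invr_gt0//.
  by rewrite mulrC ltr_pdivrMr// mul1r.
apply: filterS (limf_einf_gt _ k2) => x.
by rewrite lte_fin ltr_pdivlMr// ler_pdivlMl// => /ltW.
Qed.

End matuszewska.

(** * Iteration of the one-step inequalities *)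

Section power_bounds.
Context (R : realType).
Variables (F : R -> R) (D : R).
Hypotheses (F0 : forall x, 0 < F x) (D0 : 0 < D).
Hypothesis Fni : forall x y, x <= y -> F y <= F x.

(** A Potter-type bound: the one-step inequality is iterated while [s] exceeds [v], and the factor
    [v ^ q] pays for the last ratio, which lies between 1 and [v]. *)
Lemma tail_power_decay v q : 1 < v -> 0 < q ->
  (forall x, D <= x -> F (v * x) <= v `^ (- q) * F x) ->
  forall s x, 1 <= s -> D <= x -> F (s * x) <= v `^ q * s `^ (- q) * F x.
Proof.
move=> v1 q0 H s x s1 Dx; have v0 : 0 < v by exact: lt_trans v1.
have [n] := exists_expr_gt s v1.
elim: n s s1 => [|n IH] s s1 sv.
  by move: sv; rewrite expr0 ltNge s1.
have s0 : 0 < s by exact: lt_le_trans s1.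
have x0 : 0 < x by exact: lt_le_trans Dx.
have [svle|vs] := leP s v.
  apply: (@le_trans _ _ (F x)); first by apply: Fni; rewrite ler_peMl// ltW.
  rewrite ler_peMl ?(ltW (F0 x))// powRN ler_pdivlMr ?powR_gt0//.
  by rewrite mul1r ge0_ler_powR ?nnegrE ?(ltW q0) ?(ltW s0) ?(ltW v0).
have -> : s * x = v * ((s / v) * x) by field; rewrite gt_eqF.
have sv1 : 1 <= s / v by rewrite ler_pdivlMr// mul1r ltW.
apply: le_trans (H _ _) _.
  by apply: (le_trans Dx); rewrite ler_peMl ?(ltW x0).
have := IH (s / v) sv1; rewrite ltr_pdivrMr// -exprSr => /(_ sv) IHs.
apply: (@le_trans _ _ (v `^ (- q) * (v `^ q * (s / v) `^ (- q) * F x))).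
  by rewrite ler_wpM2l// powR_ge0.
rewrite !mulrA ler_pM2r//.
rewrite powRM ?invr_ge0 ?(ltW s0) ?(ltW v0)//.
rewrite -powR_inv1 ?(ltW v0)// -powRrM mulN1r opprK.
rewrite -!mulrA [X in _ * (_ * X)]mulrC [X in _ * X]mulrCA !mulrA.
by rewrite -[X in X * _ * _]powRD ?addNr ?powRr0 ?mul1r// (gt_eqF v0) implybT.
Qed.

(** Once [v ^ n] exceeds the inverse of [e], going up [n] steps from [e * x] passes [x], so
    [C = K ^ n] works. *)
Lemma tail_scale_bound v K e : 1 < v -> 0 < K -> 0 < e ->
  (forall x, D <= x -> F x <= K * F (v * x)) ->
  exists2 C, 0 < C & forall x, D <= e * x -> F (e * x) <= C * F x.
Proof.
move=> v1 K0 e0 H; have v0 : 0 < v by exact: lt_trans v1.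
have it n x : D <= x -> F x <= K ^+ n * F (v ^+ n * x).
  move=> Dx; elim: n => [|n IH]; first by rewrite !expr0 !mul1r.
  apply: le_trans IH _; rewrite exprSr -mulrA ler_pM2l ?exprn_gt0//.
  rewrite exprS -mulrA; apply: H; apply: (le_trans Dx).
  have x0 := lt_le_trans D0 Dx.
  by rewrite ler_peMl ?exprn_ege1 ?(ltW v1) ?(ltW x0).
have [n nv] := exists_expr_gt e^-1 v1.
exists (K ^+ n) => [|x Dx]; first exact: exprn_gt0.
apply: le_trans (it n _ Dx) _; rewrite ler_pM2l ?exprn_gt0//; apply: Fni.
have x0 : 0 < x by rewrite -(pmulr_rgt0 _ e0); exact: lt_le_trans Dx.
by rewrite mulrA ler_peMl// ?(ltW x0)// -ler_pdivrMr// mul1r ltW.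
Qed.

(* [M] stands for the normalised truncated moment [y |-> E min(Y / y, 1)^p];
   the recursion below replaces Karamata's theorem. *)
Lemma truncated_moment_bound (M : R -> R) v K a : 1 < v -> 0 < K -> 0 <= a ->
  K * a < 1 -> (forall x, D <= x -> F x <= K * F (v * x)) ->
  (forall y, M y <= 1) ->
  (forall y, 0 < y -> M (v * y) <= a * M y + F y) ->
  exists2 B, 0 < B & forall y, D <= y -> M y <= B * F y.
Proof.
move=> v1 K0 a0 Ka HF M1 HM; have v0 : 0 < v by exact: lt_trans v1.
have Ka0 : 0 < 1 - K * a by rewrite subr_gt0.
(* The first summand settles [y <= v * D], where [M <= 1] suffices. The second one gives
   [(a * B + 1) * K <= B], so that the recursion preserves the bound. *)
pose B := (F (v * D))^-1 + K / (1 - K * a).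
have B0 : 0 < B by rewrite addr_gt0 ?invr_gt0 ?divr_gt0.
exists B => // y Dy.
have base z : z <= v * D -> M z <= B * F z.
  move=> zD; apply: le_trans (M1 z) _; rewrite -ler_pdivrMr// mul1r.
  apply: (@le_trans _ _ (F (v * D))^-1); last by rewrite lerDl divr_ge0// ltW.
  by rewrite lef_pV2 ?posrE ?Fni.
have [n] := exists_expr_gt (y / D) v1; rewrite ltr_pdivrMr//.
elim: n y Dy => [|n IH] y Dy yv.
  by move: yv; rewrite expr0 mul1r ltNge Dy.
have [yD|yD] := leP y (v * D); first exact: base.
have Dyv : D <= y / v by rewrite ler_pdivlMr// mulrC ltW.
have yE : y = v * (y / v) by field; rewrite gt_eqF.
have IHy : M (y / v) <= B * F (y / v).
  by apply: IH => //; rewrite ltr_pdivrMr// mulrAC -exprSr.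
have := HM (y / v) (lt_le_trans D0 Dyv); rewrite -yE.
move=> /le_trans; apply.
have := HF _ Dyv; rewrite -yE => HFy.
apply: (@le_trans _ _ ((a * B + 1) * F (y / v))).
  by rewrite mulrDl mul1r lerD2r -mulrA ler_wpM2l.
have aB : 0 < a * B + 1 by rewrite ltr_wpDl// mulr_ge0// ltW.
apply: (@le_trans _ _ ((a * B + 1) * (K * F y))); first by rewrite ler_pM2l.
rewrite mulrA ler_pM2r//.
have : K / (1 - K * a) <= B by rewrite lerDr invr_ge0 ltW.
rewrite ler_pdivrMr// => h; nra.
Qed.

End power_bounds.

(** * Sums of quasi asymptotically independent variables *)

(** No two terms exceed [e], so one term contributes at most [a] and the others at most [e] each. *)
Lemma sum_le_one_large (R : realType) (z : nat -> R) n a e :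
  0 <= a -> 0 <= e -> (forall i, (i < n)%N -> z i <= a) ->
  (forall i j, (j < i < n)%N -> ~ (e < z i /\ e < z j)) ->
  \sum_(i < n) z i <= a + n%:R * e.
Proof.
move=> a0 e0; elim: n => [|n IH] za ze; first by rewrite big_ord0 mul0r addr0.
rewrite big_ord_recr /= -natr1 mulrDl mul1r addrA.
have [zn|zn] := leP (z n) e.
  rewrite lerD// IH// => [i ni|i j /andP[ji ni]]; first exact/za/ltnW.
  by apply: ze; rewrite ji ltnW.
have : \sum_(i < n) z i <= \sum_(i < n) e.
  apply: ler_sum => i _; rewrite leNgt; apply/negP => zi.
  by apply: (ze n i) => //; rewrite ltn_ord ltnSn.
rewrite sumr_const card_ord -mulr_natl => zs.
have := za n (ltnSn n); lra.
Qed.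

Lemma near_pinfty_scale (R : realType) (Q : R -> Prop) (e : R) : 0 < e ->
  (\forall x \near +oo, Q x) -> \forall x \near +oo, Q (e * x).
Proof.
move=> e0 [M [Mr MQ]]; exists (M / e); split; first exact: num_real.
by move=> x; rewrite ltr_pdivrMr// mulrC => /MQ.
Qed.

Lemma measurable_above (R : realType) d (T : measurableType d) (f : T -> R) x :
  measurable_fun [set: T] f ->
  measurable [set w | x < f w].
Proof.
move=> mf; rewrite -[X in measurable X]setTI.
rewrite (_ : [set w | x < f w] = f @^-1` `]x, +oo[%classic).
  exact: mf.
by apply/seteqP; split => w /=; rewrite in_itv/= andbT.
Qed.

(** * Finite unions and Bonferroni's inequality *)

Section real_probability.
Context (R : realType) d (T : measurableType d) (P : probability T R).
Implicit Types A B : set T.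

Lemma fine_prob_le A B : measurable A -> measurable B -> A `<=` B ->
  fine (P A) <= fine (P B).
Proof.
move=> mA mB AB; apply: fine_le; rewrite ?fin_num_measure//.
by apply: le_measure => //; rewrite inE.
Qed.

Lemma fine_probUI A B : measurable A -> measurable B ->
  fine (P (A `|` B)) + fine (P (A `&` B)) = fine (P A) + fine (P B).
Proof.
move=> mA mB.
have mI : measurable (A `&` B) by exact: measurableI.
have mD : measurable (A `\` B) by exact: measurableD.
have -> : A `|` B = (A `\` B) `|` B.
  by rewrite setDE setUIl setvU setIT.
rewrite measureU//; last by rewrite setDKI.
have -> : P A = (P (A `\` B) + P (A `&` B))%E.
  rewrite -measureU//; last by rewrite setDE setIACA setICl setI0.
  by rewrite setUC setUIDK.
rewrite !fineD ?fin_num_measure//; lra.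
Qed.

Lemma fine_probU_le A B : measurable A -> measurable B ->
  fine (P (A `|` B)) <= fine (P A) + fine (P B).
Proof.
move=> mA mB; rewrite -fine_probUI// lerDl fine_ge0//.
Qed.

Lemma fine_prob_bigU_le n (A : nat -> set T) : (forall i, measurable (A i)) ->
  fine (P (\big[setU/set0]_(i < n) A i)) <= \sum_(i < n) fine (P (A i)).
Proof.
move=> mA; elim: n => [|n IH]; first by rewrite !big_ord0 measure0.
rewrite !big_ord_recr /=; apply: (le_trans (fine_probU_le _ _)) => //.
  exact: bigsetU_measurable.
by rewrite lerD2r.
Qed.

(** By induction: adding [A n] loses only its intersection with the previous union, which is at most
    the sum of the pairwise intersections. *)
Lemma bonferroni n (A : nat -> set T) : (forall i, measurable (A i)) ->
  \sum_(i < n) fine (P (A i)) -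
    \sum_(i < n) \sum_(j < i) fine (P (A i `&` A j)) <=
  fine (P (\big[setU/set0]_(i < n) A i)).
Proof.
move=> mA; elim: n => [|n IH]; first by rewrite !big_ord0 subr0 measure0.
rewrite !big_ord_recr /=.
have mU : measurable (\big[setU/set0]_(i < n) A i) by exact: bigsetU_measurable.
have := fine_probUI mU (mA n).
have : fine (P ((\big[setU/set0]_(i < n) A i) `&` A n)) <=
    \sum_(j < n) fine (P (A n `&` A j)).
  rewrite setIC big_distrr /=; apply: (@fine_prob_bigU_le n (fun j => A n `&` A j)).
  by move=> i; exact: measurableI.
move: IH; lra.
Qed.

End real_probability.

(** * Asymptotics of the one-dimensional series *)

Section quasi_independent_series.
Context (R : realType) d (T : measurableType d) (P : probability T R).
(** In the application [Y] are the radii of the claims, [Z] the discounted radii, [F] the common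
    tail of the [Y i], [E x] the event that the discounted claims lie in xA, and [t n] bounds the
    relative weight of the terms from [n] on. *)
Variables (Y Z : nat -> T -> R) (F : R -> R) (E : R -> set T) (t : nat -> R).
Hypotheses (mY : forall i, measurable_fun setT (Y i))
  (mZ : forall i, measurable_fun setT (Z i))
  (ZY : forall i w, Z i w <= Y i w) (Z0 : forall i w, 0 <= Z i w)
  (F0 : forall x, 0 < F x).
Hypothesis joint_tail : forall i j, i != j -> forall e, 0 < e ->
  \forall x \near +oo, fine (P [set w | x < Y i w /\ x < Y j w]) <= e * F x.
Hypothesis consistent_variation : forall e, 0 < e -> exists2 b, 0 < b < 1 &
  \forall x \near +oo, forall i,
    fine (P [set w | b * x < Z i w]) <= (1 + e) * fine (P [set w | x < Z i w]).
Hypothesis dominated_variation : forall e, 0 < e -> exists2 C, 0 < C &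
  \forall x \near +oo, F (e * x) <= C * F x.
Hypothesis first_tail : exists2 C, 0 < C &
  \forall x \near +oo, F x <= C * fine (P [set w | x < Z 0%N w]).
Hypothesis t_cvg0 : t @ \oo --> (0 : R).
Hypothesis tail_sum : \forall x \near +oo, forall n,
  (\sum_(n <= i <oo) P [set w | (x < Z i w)%R] <= (t n * F x)%:E)%E.
Hypothesis tail_event : \forall x \near +oo, forall n,
  fine (P (\bigcup_m [set w | x < \sum_(n <= i < m) Z i w])) <= t n * F x.
Hypothesis mE : \forall x \near +oo, measurable (E x).
Hypothesis lower_event : \forall x \near +oo, forall i, [set w | x < Z i w] `<=` E x.
Hypothesis upper_event : \forall x \near +oo,
  E x `<=` \bigcup_m [set w | x < \sum_(0 <= i < m) Z i w].

(** The mean number of terms exceeding [x]; it is the denominator of the quotient to be studied. *)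
Let G x : \bar R := (\sum_(0 <= i <oo) P [set w | (x < Z i w)%R])%E.

Let mtail n x : measurable (\bigcup_m [set w | x < \sum_(n <= i < m) Z i w]).
Proof.
by apply: bigcupT_measurable => m; apply: measurable_above; exact: measurable_sum.
Qed.

(** Formed with [Y], for which joint tails are controlled; it dominates the joint exceedances of the
    [Z i] because [Z i <= Y i]. *)
Let H n x := \sum_(i < n) \sum_(j < i) fine (P [set w | x < Y i w /\ x < Y j w]).

Let joint_sum n e : 0 < e -> \forall x \near +oo, H n x <= e * F x.
Proof.
(* The sum counts the pairs [j < i < n]; the successor keeps [k] positive when there are none. *)
move=> e0; pose k := (\sum_(i < n) i).+1%:R : R.
have k0 : 0 < k by rewrite ltr0n.
have : \forall x \near +oo, forall i : 'I_n, forall j : 'I_i,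
    fine (P [set w | x < Y i w /\ x < Y j w]) <= e / k * F x.
  apply: filter_forall => i; apply: filter_forall => j.
  by apply: joint_tail; rewrite ?divr_gt0// gtn_eqF.
apply: filterS => x Hx.
apply: (@le_trans _ _ (\sum_(i < n) \sum_(j < i) e / k * F x)).
  by apply: ler_sum => i _; apply: ler_sum => j _; exact: Hx.
under eq_bigr do rewrite sumr_const card_ord -mulr_natl.
rewrite -mulr_suml -natr_sum mulrA ler_pM2r// mulrCA ger_pMr//.
by rewrite ler_pdivrMr// mul1r ler_nat.
Qed.

Let ZH n x : \sum_(i < n) \sum_(j < i)
    fine (P ([set w | x < Z i w] `&` [set w | x < Z j w])) <= H n x.
Proof.
apply: ler_sum => i _; apply: ler_sum => j _; apply: fine_prob_le.
- by apply: measurableI; exact: measurable_above.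
- by apply: measurableI; exact: measurable_above.
- by move=> w [/= h1 h2]; split; [apply: lt_le_trans h1 _|apply: lt_le_trans h2 _].
Qed.

Let G_bounds : \forall x \near +oo, G x \is a fin_num /\ forall n,
  \sum_(i < n) fine (P [set w | x < Z i w]) <= fine (G x) <=
  \sum_(i < n) fine (P [set w | x < Z i w]) + t n * F x.
Proof.
apply: filterS tail_sum => x tx.
have S_ n : (\sum_(0 <= i < n) P [set w | (x < Z i w)%R])%E =
    (\sum_(i < n) fine (P [set w | x < Z i w]))%:E.
  rewrite big_mkord -sumEFin; apply: eq_bigr => i _.
  by rewrite fineK// fin_num_measure//; exact: measurable_above.
have Gfin : G x \is a fin_num.
  (* The remainder bound starting at index 0 is a bound on the whole series. *)
  rewrite ge0_fin_numE; last by apply: nneseries_ge0.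
  exact: le_lt_trans (tx 0%N) (ltry _).
split=> // n; apply/andP; split; rewrite -lee_fin fineK//.
  by rewrite -S_; exact: nneseries_lim_ge.
rewrite /G (nneseries_split 0 n)//= add0n S_ EFinD leeD2l//.
Qed.

Let lower_bound e : 0 < e -> \forall x \near +oo,
  (1 - e) * fine (G x) <= fine (P (E x)).
Proof.
move=> e0; have [C C0 hL] := first_tail.
(* One half is spent on the terms from [n] on, the other on joint exceedances; [F x <= C * G x]
   turns the total into [e * G x]. *)
have eC : 0 < e / C / 2 by rewrite !divr_gt0.
have [n tn] : exists n, t n <= e / C / 2.
  have : \forall n \near \oo, t n <= e / C / 2.
    by move/cvgr_le : t_cvg0; apply.
  by move/filter_ex.
near=> x.
have Hn : H n x <= e / C / 2 * F x by near: x; exact: joint_sum.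
have [_ /(_ n) /andP[_ Gn]] : G x \is a fin_num /\ forall n,
  \sum_(i < n) fine (P [set w | x < Z i w]) <= fine (G x) <=
  \sum_(i < n) fine (P [set w | x < Z i w]) + t n * F x by near: x.
have [_ /(_ 1%N) /andP[G1 _]] : G x \is a fin_num /\ forall n,
  \sum_(i < n) fine (P [set w | x < Z i w]) <= fine (G x) <=
  \sum_(i < n) fine (P [set w | x < Z i w]) + t n * F x by near: x.
have Fx : F x <= C * fine (P [set w | x < Z 0%N w]) by near: x.
have mEx : measurable (E x) by near: x.
have sub i : [set w | x < Z i w] `<=` E x.
  by move: i; near: x.
have U : fine (P (\big[setU/set0]_(i < n) [set w | x < Z i w])) <= fine (P (E x)).
  apply: fine_prob_le => //.
    by apply: bigsetU_measurable => i _; exact: measurable_above.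
  by rewrite -(bigcup_mkord n (fun i => [set w | x < Z i w])) => w [i _ /sub].
have := @bonferroni _ _ _ P n (fun i => [set w | x < Z i w])
  (fun i => measurable_above x (mZ i)).
have := ZH n x.
rewrite big_ord_recl big_ord0 addr0 /= in G1.
have FG : F x <= C * fine (G x) by apply: le_trans Fx _; rewrite ler_pM2l.
have eFG : e / C * F x <= e * fine (G x).
  by rewrite mulrAC ler_pdivrMr// -mulrA ler_pM2l// mulrC.
have tF : t n * F x <= e / C / 2 * F x by rewrite ler_pM2r.
move: (fine (G x)) (fine (P (E x))) (F x) U Hn Gn tF eFG => g p f.
lra.
Unshelve. all: by end_near. Qed.

(** The level [x] is split into [b * x] for one large term, half of [(1 - b) * x] shared by the
    other terms below [n], and the other half for the remainder. If all three events fail, the sum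
    cannot exceed [x]. *)
Let upper_cover n x b : 0 < x -> 0 < b < 1 ->
  \bigcup_m [set w | x < \sum_(0 <= i < m) Z i w] `<=`
  (\big[setU/set0]_(i < n) [set w | b * x < Z i w]) `|`
  (\big[setU/set0]_(i < n) \big[setU/set0]_(j < i)
     [set w | (1 - b) / 2 / n.+1%:R * x < Z i w /\
              (1 - b) / 2 / n.+1%:R * x < Z j w]) `|`
  (\bigcup_m [set w | (1 - b) / 2 * x < \sum_(n <= i < m) Z i w]).
Proof.
move=> x0 /andP[b0 b1] w [m _ /= xm].
have b2 : 0 < (1 - b) / 2 by rewrite divr_gt0// subr_gt0.
set e := _ / n.+1%:R.
have e0 : 0 < e by rewrite divr_gt0.
apply: contrapT => /not_orP[/not_orP[N1 N2] N3].
have {}N1 i : (i < n)%N -> Z i w <= b * x.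
  move=> ni; rewrite leNgt; apply/negP => h; apply: N1.
  by rewrite -(bigcup_mkord n (fun i => [set w | b * x < Z i w])); exists i.
have {}N2 i j : (j < i < n)%N -> ~ (e * x < Z i w /\ e * x < Z j w).
  move=> /andP[ji ni] h; apply: N2.
  rewrite -(bigcup_mkord n (fun i => \big[setU/set0]_(j < i)
    [set w | e * x < Z i w /\ e * x < Z j w])).
  exists i => //=.
  rewrite -(bigcup_mkord i (fun j =>
    [set w | e * x < Z i w /\ e * x < Z j w])).
  by exists j.
have {}N3 : \sum_(n <= i < m) Z i w <= (1 - b) / 2 * x.
  by rewrite leNgt; apply/negP => h; apply: N3; exists m.
have := sum_le_one_large (ltW (mulr_gt0 b0 x0)) (ltW (mulr_gt0 e0 x0)) N1 N2.
have ne : n%:R * (e * x) <= (1 - b) / 2 * x.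
  rewrite mulrA ler_pM2r// /e mulrCA ger_pMr// ler_pdivrMr ?ltr0n// mul1r.
  by rewrite ler_nat.
suff : \sum_(0 <= i < m) Z i w <= \sum_(i < n) Z i w + \sum_(n <= i < m) Z i w.
  by move: ne N3 xm; lra.
rewrite -(big_mkord xpredT (fun i => Z i w)).
have [nm|mn] := leqP n m; first by rewrite (big_cat_nat (leq0n n) nm).
rewrite [X in _ + X]big_geq ?(ltnW mn)// addr0.
by rewrite [leRHS](big_cat_nat (leq0n m) (ltnW mn))//= lerDl sumr_ge0.
Qed.

(** In the cover, single large terms cost [(1 + e) * G x] by consistent variation. Joint exceedances
    and the remainder cost [e * G x] each, since dominated variation brings [F] at a multiple of [x]
    back to [F x]. *)
Let upper_bound e : 0 < e -> \forall x \near +oo,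
  fine (P (E x)) <= (1 + 3 * e) * fine (G x).
Proof.
move=> e0; have [C C0 hL] := first_tail.
have [b b01 hb] := consistent_variation e0.
have /andP[b0 b1] := b01.
have b2 : 0 < (1 - b) / 2 by rewrite divr_gt0// subr_gt0.
have [C1 C10 hC1] := dominated_variation b2.
have eC : 0 < e / C / C1 by rewrite !divr_gt0.
have [n tn] : exists n, t n <= e / C / C1.
  have : \forall n \near \oo, t n <= e / C / C1.
    by move/cvgr_le : t_cvg0; apply.
  by move/filter_ex.
(* This threshold depends on [n], so its constant [C2] comes after [n] has been fixed; [joint_sum]
   can still absorb it. *)
set ee := (1 - b) / 2 / n.+1%:R.
have ee0 : 0 < ee by rewrite divr_gt0.
have [C2 C20 hC2] := dominated_variation ee0.
have eC2 : 0 < e / C / C2 by rewrite !divr_gt0.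
have hH := near_pinfty_scale ee0 (joint_sum n eC2).
have hT := near_pinfty_scale b2 tail_event.
near=> x.
have x0 : 0 < x by near: x; exact: nbhs_pinfty_gt.
have Hn : H n (ee * x) <= e / C / C2 * F (ee * x) by near: x.
have [_ /(_ n) /andP[Gn _]] : G x \is a fin_num /\ forall n,
  \sum_(i < n) fine (P [set w | x < Z i w]) <= fine (G x) <=
  \sum_(i < n) fine (P [set w | x < Z i w]) + t n * F x by near: x.
have [_ /(_ 1%N) /andP[G1 _]] : G x \is a fin_num /\ forall n,
  \sum_(i < n) fine (P [set w | x < Z i w]) <= fine (G x) <=
  \sum_(i < n) fine (P [set w | x < Z i w]) + t n * F x by near: x.
have Fx : F x <= C * fine (P [set w | x < Z 0%N w]) by near: x.
have mEx : measurable (E x) by near: x.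
have sub : E x `<=` \bigcup_m [set w | x < \sum_(0 <= i < m) Z i w] by near: x.
have tE : fine (P (\bigcup_m [set w | (1 - b) / 2 * x < \sum_(n <= i < m) Z i w]))
    <= t n * F ((1 - b) / 2 * x).
  by move: (n); near: x.
have F1 : F ((1 - b) / 2 * x) <= C1 * F x by near: x.
have F2 : F (ee * x) <= C2 * F x by near: x.
have bx i : fine (P [set w | b * x < Z i w]) <= (1 + e) * fine (P [set w | x < Z i w]).
  by move: i; near: x.
rewrite big_ord_recl big_ord0 addr0 /= in G1.
have FG : F x <= C * fine (G x) by apply: le_trans Fx _; rewrite ler_pM2l.
have part3 : t n * F ((1 - b) / 2 * x) <= e * fine (G x).
  apply: (@le_trans _ _ (e / C / C1 * (C1 * (C * fine (G x))))); last first.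
    by rewrite le_eqVlt; apply/orP; left; apply/eqP; field; rewrite !gt_eqF.
  apply: (@le_trans _ _ (e / C / C1 * F ((1 - b) / 2 * x))); first by rewrite ler_pM2r.
  by rewrite ler_pM2l// (le_trans F1)// ler_pM2l.
have part2 : H n (ee * x) <= e * fine (G x).
  apply: (le_trans Hn).
  apply: (@le_trans _ _ (e / C / C2 * (C2 * (C * fine (G x))))); last first.
    by rewrite le_eqVlt; apply/orP; left; apply/eqP; field; rewrite !gt_eqF.
  by rewrite ler_pM2l ?divr_gt0// (le_trans F2)// ler_pM2l.
have part1 : \sum_(i < n) fine (P [set w | b * x < Z i w]) <= (1 + e) * fine (G x).
  apply: (@le_trans _ _ (\sum_(i < n) (1 + e) * fine (P [set w | x < Z i w]))).
    by apply: ler_sum => i _.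
  by rewrite -mulr_sumr ler_pM2l// addr_gt0.
have mU1 : measurable (\big[setU/set0]_(i < n) [set w | b * x < Z i w]).
  by apply: bigsetU_measurable => i _; exact: measurable_above.
have mII i j : measurable [set w | ee * x < Z i w /\ ee * x < Z j w].
  by apply: measurableI; exact: measurable_above.
have mJ i : measurable (\big[setU/set0]_(j < i)
    [set w | ee * x < Z i w /\ ee * x < Z j w]).
  by apply: bigsetU_measurable => j _.
have mU2 : measurable (\big[setU/set0]_(i < n) \big[setU/set0]_(j < i)
    [set w | ee * x < Z i w /\ ee * x < Z j w]).
  by apply: bigsetU_measurable => i _; exact: mJ.
have mU3 := mtail n ((1 - b) / 2 * x).
have PE := fine_prob_le P mEx (measurableU _ _ (measurableU _ _ mU1 mU2) mU3)
  (subset_trans sub (@upper_cover n x b x0 b01)).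
have PU := fine_probU_le P (measurableU _ _ mU1 mU2) mU3.
have PU' := fine_probU_le P mU1 mU2.
have P1 := @fine_prob_bigU_le _ _ _ P n (fun i => [set w | b * x < Z i w])
  (fun i => measurable_above (b * x) (mZ i)).
have P2 : fine (P (\big[setU/set0]_(i < n) \big[setU/set0]_(j < i)
    [set w | ee * x < Z i w /\ ee * x < Z j w])) <= H n (ee * x).
  apply: le_trans (ZH n (ee * x)).
  apply: le_trans; first exact: (@fine_prob_bigU_le _ _ _ P n _ mJ).
  apply: ler_sum => i _.
  exact: (@fine_prob_bigU_le _ _ _ P i
    (fun j => [set w | ee * x < Z i w /\ ee * x < Z j w])).
move: PE PU PU' P1 P2 part1 part2 part3 tE; rewrite -/ee.
move: (fine (G x)) (fine (P (E x))) (F x) => g p f.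
lra.
Unshelve. all: by end_near. Qed.

Lemma quasi_independent_series :
  fine (P (E x)) / fine (\sum_(0 <= i <oo) P [set w | (x < Z i w)%R])%E
    @[x --> +oo] --> (1 : R).
Proof.
apply/cvgrPdist_le => e e0.
(* [upper_bound] loses three times its parameter. *)
have e3 : 0 < e / 3 by rewrite divr_gt0.
have [C C0 hL] := first_tail.
near=> x.
have [_ /(_ 1%N) /andP[G1 _]] : G x \is a fin_num /\ forall n,
  \sum_(i < n) fine (P [set w | x < Z i w]) <= fine (G x) <=
  \sum_(i < n) fine (P [set w | x < Z i w]) + t n * F x by near: x.
have Fx : F x <= C * fine (P [set w | x < Z 0%N w]) by near: x.
rewrite big_ord_recl big_ord0 addr0 /= in G1.
have g0 : 0 < fine (G x).
  by rewrite -(pmulr_rgt0 _ C0) (lt_le_trans (F0 x))// (le_trans Fx)// ler_pM2l.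
have lo : (1 - e) * fine (G x) <= fine (P (E x)) by near: x; exact: lower_bound.
have up : fine (P (E x)) <= (1 + 3 * (e / 3)) * fine (G x).
  by near: x; exact: upper_bound.
rewrite -/(G x) ler_distlC ler_pdivlMr// ler_pdivrMr// lo /=.
by move: up; rewrite mulrCA divff ?mulr1.
Unshelve. all: by end_near. Qed.

End quasi_independent_series.

(** * Truncated moments and remainders *)

Section independence.
Context (R : realType) d d1 d2 (T : measurableType d)
  (T1 : measurableType d1) (T2 : measurableType d2) (P : probability T R).

(** Agreement on rectangles identifies the joint law with the product of the laws; Tonelli's theorem
    then integrates over [U] with [W] frozen. *)
Lemma ge0_integral_indep (U : {RV P >-> T1}) (W : {RV P >-> T2})
    (g : T1 * T2 -> \bar R) :
  (forall A B, measurable A -> measurable B ->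
     P (U @^-1` A `&` W @^-1` B) = P (U @^-1` A) * P (W @^-1` B))%E ->
  measurable_fun [set: T1 * T2] g -> (forall z, 0 <= g z)%E ->
  (\int[P]_w g (U w, W w) = \int[P]_w \int[P]_v g (U v, W w))%E.
Proof.
move=> UW mg g0.
have mUW : measurable_fun [set: T] (fun w => (U w, W w)).
  by apply: measurable_fun_pair; exact: measurable_funPT.
pose V : {mfun T >-> (T1 * T2)%type} := mfun_Sub (mem_set mUW).
transitivity (\int[distribution P V]_z g z)%E.
  by rewrite ge0_integral_distribution.
transitivity (\int[distribution P U \x distribution P W]_z g z)%E.
  apply: eq_measure_integral => A mA _; apply/esym.
  by apply: product_measure_unique => // B C mB mC; rewrite -UW.
rewrite fubini_tonelli2// ge0_integral_distribution//=.
- apply: eq_integral => w _; rewrite /fubini_G ge0_integral_distribution//.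
  exact: measurable_fun_pair1.
- exact: measurable_fun_fubini_tonelli_G.
- by move=> y; apply: integral_ge0.
Qed.

End independence.

(** For [p >= 0] and [u >= 0] it lies between the indicator of [y < u] and 1, and for [u <= y] it is
    a pure power, so its mean links tail probabilities with moments. *)
Definition trunc_pow (R : realType) (p y u : R) : R := (Num.min (u / y) 1) `^ p.

Section trunc_pow.
Context (R : realType).
Implicit Types p u v y : R.

Lemma trunc_pow_ge0 p y u : 0 <= trunc_pow p y u.
Proof. exact: powR_ge0. Qed.

Lemma trunc_pow_le1 p y u : 0 <= p -> 0 < y -> 0 <= u -> trunc_pow p y u <= 1.
Proof.
move=> p0 y0 u0; rewrite /trunc_pow.
rewrite [leRHS](_ : 1 = 1 `^ p); last by rewrite powR1.
have uy : 0 <= u / y by rewrite divr_ge0// ltW.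
apply: ge0_ler_powR => //; rewrite ?nnegrE//.
  by rewrite le_min uy ler01.
by rewrite ge_min lexx orbT.
Qed.

Lemma trunc_pow1 p y u : 0 < y -> y < u -> trunc_pow p y u = 1.
Proof.
move=> y0 yu; rewrite /trunc_pow min_r ?powR1//.
by rewrite ler_pdivlMr// mul1r ltW.
Qed.

Lemma indic_le_trunc_pow p y u : 0 < y -> (y < u)%R%:R <= trunc_pow p y u.
Proof.
move=> y0; have [yu|_] := ltP y u; last exact: trunc_pow_ge0.
by rewrite trunc_pow1.
Qed.

(** Where [u <= y] neither minimum truncates and the power factor is exact; elsewhere the indicator
    alone suffices. Integrated, this is the recursion of [truncated_moment_bound]. *)
Lemma trunc_pow_scale p v y u : 0 <= p -> 1 < v -> 0 < y -> 0 <= u ->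
  trunc_pow p (v * y) u <= v `^ (- p) * trunc_pow p y u + (y < u)%R%:R.
Proof.
move=> p0 v1 y0 u0; have v0 : 0 < v by exact: lt_trans v1.
have [yu|uy] := ltP y u.
  apply: (le_trans (trunc_pow_le1 p0 (mulr_gt0 v0 y0) u0)).
  by rewrite lerDr mulr_ge0 ?powR_ge0.
have uy1 : u / y <= 1 by rewrite ler_pdivrMr// mul1r.
rewrite addr0 /trunc_pow !min_l//; last first.
  by rewrite ler_pdivrMr ?mulr_gt0// mul1r (le_trans uy)// ler_peMl ?ltW.
rewrite invfM mulrA (mulrC u) -mulrA powRM ?invr_ge0 ?(ltW v0) ?divr_ge0 ?(ltW y0)//.
by rewrite -[v^-1]powR_inv1 ?(ltW v0)// -powRrM mulN1r.
Qed.

Lemma measurable_trunc_pow d (T : measurableType d) p y (f : T -> R) :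
  measurable_fun [set: T] f ->
  measurable_fun [set: T] (fun w => trunc_pow p y (f w)).
Proof.
move=> mf; apply: (measurableT_comp (measurable_powR p)).
by apply: measurable_minr => //; exact: measurable_funM.
Qed.

Lemma trunc_pow_mulr p y u t : 0 < t -> trunc_pow p y (u * t) = trunc_pow p (y / t) u.
Proof. by move=> t0; rewrite /trunc_pow invf_div mulrA. Qed.

End trunc_pow.

(** * Young's inequality for weighted sums *)

Section weights.
Context (R : realType).
Implicit Types (p w V : R) (s : nat -> R).

(* Young's inequality for [V / w] and [1], multiplied by [w]. *)
Lemma young_linear p w V : 1 <= p -> 0 < w -> 0 <= V ->
  V <= w `^ (1 - p) * V `^ p / p + (1 - p^-1) * w.
Proof.
move=> p1 w0 V0; have p0 : 0 < p by exact: lt_le_trans p1.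
have t0 : 0 <= V / w by rewrite divr_ge0// ltW.
have young : V / w <= (V / w) `^ p / p + (1 - p^-1).
  (* For [p = 1] there is no finite conjugate exponent, but both sides agree. *)
  move: p1; rewrite le_eqVlt => /orP[/eqP <-|p1].
    by rewrite invr1 subrr addr0 mulr1 powRr1.
  have q0 : 0 < (1 - p^-1)^-1 by rewrite invr_gt0 subr_gt0 invf_lt1.
  have := conjugate_powR t0 (@ler01 R) p0 q0.
  by rewrite invrK powR1 mulr1 mul1r addrC subrK; exact.
rewrite -(ler_pM2r (_ : 0 < w^-1)) ?invr_gt0//.
apply: (le_trans young); rewrite mulrDl -[X in _ <= _ + X]mulrA divff ?gt_eqF// mulr1.
rewrite lerD2r mulrAC ler_pM2r ?invr_gt0//.
rewrite powRM ?invr_ge0 ?(ltW w0)// -powR_inv1 ?(ltW w0)// -powRrM mulN1r.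
rewrite mulrAC -powRD; last by rewrite (gt_eqF w0) implybT.
by rewrite addrAC subrr add0r mulrC.
Qed.

(** Summing Young's inequality with weights [s i / S] of total mass at most 1 gives
    [1 <= Q / p + (1 - p^-1)] for the weighted sum [Q], that is, [1 <= Q]. *)
Lemma weighted_power_sum s (V : nat -> R) n m S p : 1 <= p ->
  (forall i, 0 < s i) -> (forall i, 0 <= V i) -> 0 < S ->
  \sum_(n <= i < m) s i <= S -> 1 <= \sum_(n <= i < m) V i ->
  1 <= \sum_(n <= i < m) (s i / S) `^ (1 - p) * V i `^ p.
Proof.
move=> p1 s0 V0 S0 sS V1; have p0 : 0 < p by exact: lt_le_trans p1.
set Q := \sum_(n <= i < m) _.
have : \sum_(n <= i < m) V i <= Q / p + (1 - p^-1) * (\sum_(n <= i < m) s i / S).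
  rewrite /Q mulr_suml mulr_sumr -big_split /=; apply: ler_sum => i _.
  by apply: young_linear; rewrite ?divr_gt0.
rewrite -mulr_suml => VQ.
have wS : (\sum_(n <= i < m) s i) / S <= 1 by rewrite ler_pdivrMr// mul1r.
have : 1 <= Q / p + (1 - p^-1).
  apply: (le_trans V1); apply: (le_trans VQ); rewrite lerD2l ler_piMr//.
  by rewrite subr_ge0 invf_le1.
by rewrite addrCA lerDl subr_ge0 -[X in X <= _]mul1r ler_pM2r ?invr_gt0.
Qed.

(** For moments of order [s ^ p] this choice of weight leaves a bound linear in [s], hence
    summable. *)
Lemma weight_powR (s S p : R) : 0 < s -> 0 < S ->
  (s / S) `^ (1 - p) * s `^ p = s * S `^ (p - 1).
Proof.
move=> s0 S0.
rewrite powRM ?invr_ge0 ?(ltW s0) ?(ltW S0)//.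
rewrite -[S^-1]powR_inv1 ?(ltW S0)// -powRrM mulN1r opprB.
rewrite mulrAC -powRD; last by rewrite (gt_eqF s0) implybT.
by rewrite subrK powRr1 ?ltW.
Qed.

End weights.

Section moments.
Context (R : realType) d (T : measurableType d) (P : probability T R).

Lemma measurable_indic_above (f : T -> R) x : measurable_fun [set: T] f ->
  measurable_fun [set: T] (fun w => (x < f w)%R%:R%:E : \bar R).
Proof.
move=> mf; rewrite (_ : (fun _ => _) = EFin \o \1_[set w | x < f w]).
  by apply/measurable_EFinP; apply: measurable_indic; exact: measurable_above.
by apply/funext => w /=; rewrite indicE mem_setE.
Qed.

Lemma prob_above_integral (f : T -> R) x : measurable_fun [set: T] f ->
  P [set w | x < f w] = (\int[P]_w (x < f w)%R%:R%:E)%E.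
Proof.
move=> mf; rewrite -(setIT [set w | x < f w]) -integral_indic//; last first.
  exact: measurable_above.
by apply: eq_integral => w _; rewrite indicE mem_setE.
Qed.

Lemma integral_trunc_pow_le1 p y (W : T -> R) : measurable_fun [set: T] W ->
  0 <= p -> 0 < y -> (forall w, 0 <= W w) ->
  (\int[P]_w (trunc_pow p y (W w))%:E <= 1)%E.
Proof.
move=> mW p0 y0 W0.
apply: (@le_trans _ _ (\int[P]_w (cst 1 w))%E).
  apply: ge0_le_integral => //.
  - by move=> w _; rewrite lee_fin trunc_pow_ge0.
  - by apply/measurable_EFinP; exact: measurable_trunc_pow.
  - by move=> w _; rewrite lee_fin trunc_pow_le1.
by rewrite integral_cst// mul1e; exact: probability_le1.
Qed.

Lemma trunc_moment_bound (W : T -> R) (F : R -> R) p v K D :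
  measurable_fun [set: T] W -> (forall w, 0 <= W w) -> 0 <= p ->
  (forall x, fine (P [set w | x < W w]) = F x) ->
  (forall x, 0 < F x) -> 0 < D -> (forall x y, x <= y -> F y <= F x) ->
  1 < v -> 0 < K -> K * v `^ (- p) < 1 ->
  (forall x, D <= x -> F x <= K * F (v * x)) ->
  exists2 B, 0 < B & forall y, D <= y ->
    (\int[P]_w (trunc_pow p y (W w))%:E <= (B * F y)%:E)%E.
Proof.
move=> mW W0 p0 PF F0 D0 Fni v1 K0 Kv HF.
pose I y := (\int[P]_w (trunc_pow p y (W w))%:E)%E.
have I0 y : (0 <= I y)%E.
  by apply: integral_ge0 => w _; rewrite lee_fin trunc_pow_ge0.
have Ifin y : 0 < y -> I y \is a fin_num.
  move=> y0; rewrite ge0_fin_numE//.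
  by apply: le_lt_trans (integral_trunc_pow_le1 mW p0 y0 W0) (ltry _).
have v0 : 0 < v by exact: lt_trans v1.
(* The value 0 off the positive half-line keeps [M <= 1] valid for every [y]. *)
pose M y := if 0 < y then fine (I y) else 0.
have [B B0 HB] : exists2 B, 0 < B & forall y, D <= y -> M y <= B * F y.
  apply: (@truncated_moment_bound _ F D F0 D0 Fni M v K (v `^ (- p))) => //.
  - exact: powR_ge0.
  - move=> y; rewrite /M; case: ifPn => // y0.
    rewrite -lee_fin fineK ?Ifin//; exact: integral_trunc_pow_le1.
  - move=> y y0; rewrite /M y0 mulr_gt0// -lee_fin fineK ?Ifin ?mulr_gt0//.
    rewrite EFinD EFinM fineK ?Ifin// -PF fineK; last first.
      by rewrite fin_num_measure//; exact: measurable_above.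
    rewrite prob_above_integral// -ge0_integralZl//; last 3 first.
    + by apply/measurable_EFinP; exact: measurable_trunc_pow.
    + by move=> w _; rewrite lee_fin trunc_pow_ge0.
    + by rewrite lee_fin powR_ge0.
    have mi : measurable_fun [set: T] (fun w => (y < W w)%R%:R%:E : \bar R).
      exact: measurable_indic_above.
    have mt : measurable_fun [set: T]
        (fun w => (v `^ (- p))%:E * (trunc_pow p y (W w))%:E)%E.
      by apply: measurable_funeM; apply/measurable_EFinP; exact: measurable_trunc_pow.
    rewrite -ge0_integralD//; last first.
      by move=> w _; rewrite mule_ge0 ?lee_fin ?powR_ge0 ?trunc_pow_ge0.
    apply: ge0_le_integral => //.
    + by move=> w _; rewrite lee_fin trunc_pow_ge0.
    + by apply/measurable_EFinP; exact: measurable_trunc_pow.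
    + exact: emeasurable_funD.
    + by move=> w _; rewrite -EFinM -EFinD lee_fin trunc_pow_scale.
exists B => // y Dy; have y0 : 0 < y by exact: lt_le_trans Dy.
rewrite -/(I y) -[I y]fineK ?Ifin// lee_fin.
by have := HB y Dy; rewrite /M y0.
Qed.

End moments.

(** * Remainder bounds uniform in the level *)

Section tail_estimates.
Context (R : realType) d (T : measurableType d) (P : probability T R).
Variables (Z : nat -> T -> R) (F : R -> R) (s : nat -> R) (p B D : R).
Hypotheses (mZ : forall i, measurable_fun [set: T] (Z i))
  (Z0 : forall i w, 0 <= Z i w) (F0 : forall x, 0 < F x)
  (s0 : forall i, 0 < s i) (p1 : 1 <= p) (B0 : 0 < B) (D0 : 0 < D).
Hypothesis s_summable : (\sum_(0 <= i <oo) (s i)%:E < +oo)%E.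
Hypothesis moment : forall i y, D <= y ->
  (\int[P]_w (trunc_pow p y (Z i w))%:E <= (B * s i `^ p * F y)%:E)%E.

Let S n := fine (\sum_(n <= i <oo) (s i)%:E)%E.

Let s_ge0 i : (0 <= (s i)%:E)%E. Proof. by rewrite lee_fin ltW. Qed.

Let S_E n : (\sum_(n <= i <oo) (s i)%:E)%E = (S n)%:E.
Proof.
rewrite fineK// ge0_fin_numE; last by apply: nneseries_ge0.
apply: le_lt_trans s_summable.
rewrite (nneseries_split 0 n)// add0n leeDr//.
by apply: sume_ge0.
Qed.

Let sum_le_S n m : \sum_(n <= i < m) s i <= S n.
Proof.
rewrite -lee_fin -S_E -sumEFin; exact: nneseries_lim_ge.
Qed.

Let S_gt0 n : 0 < S n.
Proof.
by apply: lt_le_trans (sum_le_S n n.+1); rewrite big_nat1.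
Qed.

Let S_ni n : S n <= S 0.
Proof.
rewrite -lee_fin -!S_E (nneseries_split 0 n)// add0n leeDr//.
by apply: sume_ge0.
Qed.

(** The factor [S n] gives convergence to 0, while the power of [S 0] bounds both [s i ^ (p - 1)]
    and [S n ^ (p - 1)], so one sequence serves both estimates. *)
Let t n := B * S 0 `^ (p - 1) * S n.

Let t_cvg0 : t @ \oo --> (0 : R).
Proof.
have S0 : S @ \oo --> (0 : R).
  by apply: fine_cvg; apply: nneseries_tail_cvg.
rewrite -[0](mulr0 (B * S 0 `^ (p - 1))).
by apply: cvgM => //; exact: cvg_cst.
Qed.

Let p_ge0 : 0 <= p. Proof. exact: le_trans p1. Qed.

Let tail_sum y n : D <= y ->
  (\sum_(n <= i <oo) P [set w | (y < Z i w)%R] <= (t n * F y)%:E)%E.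
Proof.
move=> Dy; have y0 : 0 < y by exact: lt_le_trans Dy.
apply: (@le_trans _ _ (\sum_(n <= i <oo) (B * S 0 `^ (p - 1) * F y)%:E * (s i)%:E)%E).
  apply: lee_nneseries => // i _; rewrite prob_above_integral//.
  apply: (@le_trans _ _ (\int[P]_w (trunc_pow p y (Z i w))%:E)%E).
    apply: ge0_le_integral => //.
    - exact: measurable_indic_above.
    - by apply/measurable_EFinP; exact: measurable_trunc_pow.
    - by move=> w _; rewrite lee_fin indic_le_trunc_pow.
  apply: (le_trans (moment i Dy)); rewrite -EFinM lee_fin.
  rewrite -[leRHS]mulrA [leRHS]mulrCA [leRHS]mulrC -!mulrA ler_pM2l//.
  rewrite [leRHS]mulrCA [leRHS]mulrA ler_pM2r//.
  rewrite -(mulr_powRB1 (ltW (s0 i))) ?(lt_le_trans ltr01 p1)//.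
  rewrite ler_pM2l// ge0_ler_powR ?subr_ge0 ?nnegrE ?(ltW (s0 _)) ?(ltW (S_gt0 _))//.
  apply: le_trans (S_ni i); apply: le_trans (sum_le_S i i.+1).
  by rewrite big_nat1.
rewrite nneseriesZl//.
by rewrite S_E -EFinM lee_fin /t mulrAC.
Qed.

Let partial_tail y n m : D <= y ->
  (P [set w | (y < \sum_(n <= i < m) Z i w)%R] <= (t n * F y)%:E)%E.
Proof.
move=> Dy; have y0 : 0 < y by exact: lt_le_trans Dy.
pose a i := (s i / S n) `^ (1 - p).
have a0 i : 0 <= a i by exact: powR_ge0.
have mt i : measurable_fun [set: T] (fun w => (a i)%:E * (trunc_pow p y (Z i w))%:E)%E.
  by apply: measurable_funeM; apply/measurable_EFinP; exact: measurable_trunc_pow.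
have t0 i w : (0 <= (a i)%:E * (trunc_pow p y (Z i w))%:E)%E.
  by rewrite mule_ge0 ?lee_fin ?trunc_pow_ge0.
rewrite prob_above_integral; last exact: measurable_sum.
apply: (@le_trans _ _
  (\int[P]_w \sum_(n <= i < m) ((a i)%:E * (trunc_pow p y (Z i w))%:E))%E).
  apply: ge0_le_integral => //.
  - by apply: measurable_indic_above; exact: measurable_sum.
  - exact: emeasurable_sum.
  - move=> w _; have [yS|_] := ltP y; last by apply: sume_ge0.
    under eq_bigr do rewrite -EFinM.
    rewrite sumEFin lee_fin.
    apply: (@weighted_power_sum _ s (fun i => Num.min (Z i w / y) 1)) => //.
      by move=> i; rewrite le_min ler01 andbT divr_ge0// ltW.
    (* The truncated terms add up to at least 1: either some term exceeds [y] and is truncated to 1,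
       or nothing is truncated and the sum is that of the [Z i], divided by [y]. *)
    have [[i ni yi]|] := pselect (exists2 i, (n <= i < m)%N & y < Z i w).
      rewrite (bigD1_seq i) ?mem_index_iota ?iota_uniq//= min_r; last first.
        by rewrite ler_pdivlMr// mul1r ltW.
      rewrite lerDl sumr_ge0// => j _.
      by rewrite le_min ler01 andbT divr_ge0// ltW.
    move=> /forall2NP small.
    rewrite (eq_big_nat _ _ (F2 := fun i => Z i w / y)); last first.
      move=> i ni; rewrite min_l// ler_pdivrMr// mul1r leNgt; apply/negP.
      by have [] := small i.
    by rewrite -mulr_suml ler_pdivlMr// mul1r ltW.
rewrite ge0_integral_sum//.
apply: (@le_trans _ _ (\sum_(n <= i < m) (B * F y * S n `^ (p - 1))%:E * (s i)%:E)%E).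
  apply: lee_sum => i _; rewrite ge0_integralZl//; last 3 first.
  - by apply/measurable_EFinP; exact: measurable_trunc_pow.
  - by move=> w _; rewrite lee_fin trunc_pow_ge0.
  - by rewrite lee_fin.
  apply: (@le_trans _ _ ((a i)%:E * (B * s i `^ p * F y)%:E)%E).
    by rewrite lee_pmul2l ?moment// ?fin_numE// lte_fin powR_gt0// divr_gt0.
  rewrite -!EFinM lee_fin [leLHS](_ : _ = B * F y * (a i * s i `^ p)); last by ring.
  rewrite /a weight_powR// le_eqVlt; apply/orP; left; apply/eqP; ring.
under eq_bigr do rewrite -EFinM.
rewrite sumEFin lee_fin -mulr_sumr /t.
apply: (@le_trans _ _ (B * F y * S 0 `^ (p - 1) * S n)); last first.
  by rewrite [leLHS](_ : _ = B * S 0 `^ (p - 1) * S n * F y)//; ring.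
apply: ler_pM => //.
- by rewrite !mulr_ge0 ?powR_ge0// ltW.
- by apply: sumr_ge0 => i _; rewrite ltW.
- rewrite ler_pM2l ?mulr_gt0// ge0_ler_powR ?subr_ge0 ?nnegrE ?(ltW (S_gt0 _))//.
Qed.

Lemma tail_estimates : exists2 t : nat -> R, t @ \oo --> (0 : R) &
  forall y n, D <= y ->
    (\sum_(n <= i <oo) P [set w | (y < Z i w)%R] <= (t n * F y)%:E)%E /\
    fine (P (\bigcup_m [set w | y < \sum_(n <= i < m) Z i w])) <= t n * F y.
Proof.
exists t => // y n Dy; split; first exact: tail_sum.
have mA m : measurable [set w | y < \sum_(n <= i < m) Z i w].
  by apply: measurable_above; exact: measurable_sum.
have mU : measurable (\bigcup_m [set w | y < \sum_(n <= i < m) Z i w]).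
  exact: bigcupT_measurable.
rewrite -lee_fin fineK ?fin_num_measure//.
(* The terms are nonnegative, so the events increase with [m], and the bound, being uniform in [m],
   passes to their union. *)
have nd : nondecreasing_seq (fun m => [set w | y < \sum_(n <= i < m) Z i w]).
  move=> m m' mm'; apply/subsetPset => w /= /lt_le_trans; apply.
  have [nm|mn] := leqP n m; last by rewrite big_geq ?sumr_ge0// ltnW.
  by rewrite (big_cat_nat nm mm')//= lerDl sumr_ge0.
have cv := @nondecreasing_cvg_mu _ _ _ P _ mA mU nd.
rewrite -(cvg_lim _ cv)//; apply: lime_le; first by apply/cvg_ex; eexists; exact: cv.
by apply: nearW => m; exact: partial_tail.
Qed.

End tail_estimates.

(** * Discounted claims *)

Section risk_model.
Context (R : realType) (d : nat) (dOmega dOmega' : measure_display)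
  (Omega : measurableType dOmega) (P : probability Omega R)
  (Omega' : measurableType dOmega') (P' : probability Omega' R)
  (A : set 'rV[R]_d) (r : R) (X0 : {RV P' >-> borel_rV R d})
  (X : nat -> {RV P >-> borel_rV R d}) (tau : nat -> {RV P >-> R}).
Hypotheses (hA : ruin_family A) (hr : 0 < r)
  (X_ge0 : forall i w, nonneg_vec (X i w))
  (hXid : forall i (B : set (borel_rV R d)), measurable B ->
    distribution P (X i) B = distribution P' X0 B)
  (tau_ge0 : forall i w, 0 <= tau i w)
  (hindep : indep_seq P (fun i => X i) (fun i => tau i)).

Let Y i w := scale_radius A (X i w).
Let theta i w := expR (- (r * tau i w)).
Let Z i w := Y i w * theta i w.
Let FA := distr_fun P' (fun w => scale_radius A (X0 w)).
Let F := tail FA.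

Let mY i : measurable_fun [set: Omega] (Y i).
Proof.
apply: (@measurableT_comp _ _ _ _ _ _ (scale_radius A : borel_rV R d -> R)).
  exact: measurable_scale_radius.
exact: measurable_funPT.
Qed.

Let mY0 : measurable_fun [set: Omega'] (fun w => scale_radius A (X0 w)).
Proof.
apply: (@measurableT_comp _ _ _ _ _ _ (scale_radius A : borel_rV R d -> R)).
  exact: measurable_scale_radius.
exact: measurable_funPT.
Qed.

Let mdiscount : measurable_fun [set: R] (fun t => expR (- (r * t))).
Proof.
apply: (measurableT_comp (@measurable_expR R)).
by apply: measurableT_comp => //; exact: measurable_funM.
Qed.

Let mtheta i : measurable_fun [set: Omega] (theta i).
Proof. by apply: (measurableT_comp mdiscount); exact: measurable_funPT. Qed.

Let mZ i : measurable_fun [set: Omega] (Z i).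
Proof. exact: measurable_funM. Qed.

Let Y_ge0 i w : 0 <= Y i w. Proof. exact: scale_radius_ge0. Qed.

Let theta_gt0 i w : 0 < theta i w. Proof. exact: expR_gt0. Qed.

Let theta_le1 i w : theta i w <= 1.
Proof. by rewrite expR_le1 oppr_le0 mulr_ge0// ltW. Qed.

Let Z_ge0 i w : 0 <= Z i w. Proof. by rewrite mulr_ge0// ltW. Qed.

Let Z_le_Y i w : Z i w <= Y i w.
Proof. by rewrite ler_piMr. Qed.

Let tail_distr_fun d1 (T : measurableType d1) (Q : probability T R) (f : T -> R) x :
  measurable_fun [set: T] f -> (tail (distr_fun Q f) x)%:E = Q [set w | x < f w].
Proof.
move=> mf.
have mB : measurable [set w | x < f w] by exact: measurable_above.
have -> : [set w | x < f w] = ~` [set w | f w <= x].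
  by apply/seteqP; split => w /=; rewrite ltNge => /negP.
have mC : measurable [set w | f w <= x].
  rewrite (_ : [set w | f w <= x] = ~` [set w | x < f w]).
    exact: measurableC.
  by apply/seteqP; split => w /=; rewrite leNgt => /negP.
rewrite probability_setC// /tail /distr_fun EFinB fineK//.
by rewrite fin_num_measure.
Qed.

Let prob_Y i x : P [set w | x < Y i w] = (F x)%:E.
Proof.
rewrite /F tail_distr_fun//.
have mB : measurable ([set z | x < scale_radius A z] : set (borel_rV R d)).
  by apply: measurable_above; exact: measurable_scale_radius.
exact: (hXid i mB).
Qed.

Let tail_Y i x : tail (distr_fun P (Y i)) x = F x.
Proof. by apply: EFin_inj; rewrite tail_distr_fun// prob_Y. Qed.

Let F_ge0 x : 0 <= F x.
Proof. by rewrite -lee_fin -(prob_Y 0). Qed.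

Let F_ni x y : x <= y -> F y <= F x.
Proof.
move=> xy; rewrite -lee_fin -!(prob_Y 0); apply: le_measure.
- by rewrite inE; exact: measurable_above.
- by rewrite inE; exact: measurable_above.
- by move=> w /=; exact: le_lt_trans.
Qed.

Let X_tau_indep i (B : set (borel_rV R d)) (C : set R) :
  measurable B -> measurable C ->
  (P (X i @^-1` B `&` tau i @^-1` C) = P (X i @^-1` B) * P (tau i @^-1` C))%E.
Proof.
move=> mB mC; apply: hindep; apply: sub_sigma_algebra; exists i => //.
  by exists B => //; rewrite setTI.
by exists C => //; rewrite setTI.
Qed.

Let indep_integral i (g : R -> R -> \bar R) :
  measurable_fun [set: R * R] (fun z => g z.1 z.2) ->
  (forall u t, 0 <= g u t)%E ->
  (\int[P]_w g (Y i w) (tau i w) =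
   \int[P]_w \int[P]_v g (Y i v) (tau i w))%E.
Proof.
move=> mg g0.
apply: (@ge0_integral_indep _ _ _ _ _ _ _ P (X i) (tau i)
  (fun z => g (scale_radius A z.1) z.2) (X_tau_indep i)) => //.
rewrite (_ : (fun z => _) = (fun z => g z.1 z.2) \o
  (fun z : borel_rV R d * R => (scale_radius A z.1, z.2)))//.
apply: measurableT_comp => //; apply: measurable_fun_pair => //.
apply: (@measurableT_comp _ _ _ _ _ _ (scale_radius A : borel_rV R d -> R)) => //.
exact: measurable_scale_radius.
Qed.

Let mZ_joint : measurable_fun [set: R * R] (fun z => z.1 * expR (- (r * z.2))).
Proof.
apply: measurable_funM => //.
by apply: (measurableT_comp mdiscount).
Qed.

Let above_Z u t x : (x < u * expR (- (r * t))) = (x * expR (r * t) < u).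
Proof. by rewrite expRN ltr_pdivlMr ?expR_gt0. Qed.

Let prob_Z i x : P [set w | x < Z i w] =
  (\int[P]_w (F (x * expR (r * tau i w)))%:E)%E.
Proof.
rewrite prob_above_integral//.
rewrite (@indep_integral i (fun u t => (x < u * expR (- (r * t)))%R%:R%:E))//.
- apply: eq_integral => w _; rewrite -(prob_Y i) prob_above_integral//.
  by apply: eq_integral => v _; rewrite above_Z.
- exact: measurable_indic_above.
Qed.

Let mF i x : measurable_fun [set: Omega] (fun w => (F (x * expR (r * tau i w)))%:E).
Proof.
apply/measurable_EFinP.
apply: (@measurableT_comp _ _ _ _ _ _ F).
  by apply: nonincreasing_measurable => // u v _ _; exact: F_ni.
apply: measurable_funM => //; apply: (measurableT_comp (@measurable_expR R)).
by apply: measurable_funM => //; exact: measurable_funPT.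
Qed.

Let exp_tau_ge1 i w : 1 <= expR (r * tau i w).
Proof. by rewrite -expR0 ler_expR mulr_ge0// ltW. Qed.

(** The inequality for [F] applies under the integral over arrival times because discounting only
    raises the threshold above [x]; hence the uniformity in [i]. *)
Let prob_Z_consistent (b e D : R) : 0 < D -> 0 <= e ->
  (forall x, D <= x -> F (b * x) <= (1 + e) * F x) ->
  forall x i, D <= x ->
  fine (P [set w | b * x < Z i w]) <= (1 + e) * fine (P [set w | x < Z i w]).
Proof.
move=> D0 e0 H x i Dx.
have fin y : P [set w | y < Z i w] \is a fin_num.
  by rewrite fin_num_measure//; exact: measurable_above.
rewrite -lee_fin EFinM !fineK// !prob_Z -ge0_integralZl//; last 2 first.
- by move=> w _; rewrite lee_fin.
- by rewrite lee_fin addr_ge0.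
apply: ge0_le_integral => //.
- by move=> w _; rewrite lee_fin.
- by apply: measurable_funeM.
move=> w _; rewrite -EFinM lee_fin -mulrA; apply: H.
by apply: (le_trans Dx); rewrite ler_peMr// (le_trans (ltW D0)).
Qed.

(** With the arrival time frozen, the discount moves into the threshold [y], and the power decay of
    [F] converts it into the factor [exp (- q r tau i)]. *)
Let moment_Z (p q B C D : R) : 0 < D -> 0 <= B -> 0 <= C ->
  (forall i y, D <= y ->
    (\int[P]_w (trunc_pow p y (Y i w))%:E <= (B * F y)%:E)%E) ->
  (forall s x, 1 <= s -> D <= x -> F (s * x) <= C * s `^ (- q) * F x) ->
  forall i y, D <= y ->
  (\int[P]_w (trunc_pow p y (Z i w))%:E <=
   (B * C * F y)%:E * 'E_P[fun w => expR (- (q * r * tau i w))])%E.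
Proof.
move=> D0 B0 C0 HB HC i y Dy.
have mtp : measurable_fun [set: R * R]
    (fun z => (trunc_pow p y (z.1 * expR (- (r * z.2))))%:E).
  by apply/measurable_EFinP; exact: measurable_trunc_pow.
rewrite (@indep_integral i
  (fun u t => (trunc_pow p y (u * expR (- (r * t))))%:E))//; last first.
  by move=> u t; rewrite lee_fin trunc_pow_ge0.
have me : measurable_fun [set: Omega] (fun w => (expR (- (q * r * tau i w)))%:E).
  apply/measurable_EFinP; apply: (measurableT_comp (@measurable_expR R)).
  by apply: measurableT_comp => //; exact: measurable_funM.
rewrite unlock -ge0_integralZl//; last by rewrite lee_fin !mulr_ge0.
apply: ge0_le_integral => //.
- by move=> w _; apply: integral_ge0 => v _; rewrite lee_fin trunc_pow_ge0.
- apply: (measurableT_comp (f := fun t =>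
    \int[P]_v (trunc_pow p y (Y i v * expR (- (r * t))))%:E)%E); last first.
    exact: measurable_funPT.
  have mYt : measurable_fun [set: Omega * R]
      (fun z => (trunc_pow p y (Y i z.1 * expR (- (r * z.2))))%:E).
    apply/measurable_EFinP; apply: measurable_trunc_pow; apply: measurable_funM.
      exact: measurableT_comp.
    exact: (measurableT_comp mdiscount).
  apply: (@measurable_fun_fubini_tonelli_G _ _ _ _ _ P _ mYt).
  by move=> z; rewrite lee_fin trunc_pow_ge0.
- by apply: measurable_funeM.
move=> w _; under eq_integral do rewrite trunc_pow_mulr ?expR_gt0//.
have -> : y / expR (- (r * tau i w)) = expR (r * tau i w) * y.
  by rewrite expRN invrK mulrC.
apply: (le_trans (HB i _ _)).
  by apply: (le_trans Dy); rewrite ler_peMl// (le_trans (ltW D0)).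
rewrite -EFinM lee_fin -!mulrA ler_wpM2l//.
apply: (le_trans (HC _ _ (exp_tau_ge1 i w) Dy)).
rewrite -mulrA ler_wpM2l// mulrC ler_wpM2l//.
rewrite -expRM le_eqVlt; apply/orP; left; apply/eqP; congr expR; ring.
Qed.

(** The first arrival time is finite, so it is at most some [n] with positive probability. There the
    discount is at least [exp (- r n)], which dominated variation absorbs. *)
Let first_tail : (forall x, 0 < F x) ->
  (forall e, 0 < e -> exists2 C, 0 < C &
    \forall x \near +oo, F (e * x) <= C * F x) ->
  exists2 C, 0 < C &
  \forall x \near +oo, F x <= C * fine (P [set w | x < Z 0%N w]).
Proof.
move=> F0 hC1.
pose B (n : nat) := [set w | tau 0%N w <= n%:R].
have mB n : measurable (B n).
  rewrite /B -[X in measurable X]setTI.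
  rewrite (_ : [set w | _] = tau 0%N @^-1` `]-oo, n%:R]%classic).
    by apply: (@measurable_funPT _ _ _ _ (tau 0%N)).
  by apply/seteqP; split => w /=; rewrite in_itv.
have [n Bn] : exists n, P (B n) != 0%E.
  apply: contrapT => /forallNP B0.
  have : P.-negligible (\bigcup_n B n).
    apply: negligible_bigcup => n; apply/negligibleP => //.
    by apply/eqP/negbNE/negP/B0.
  rewrite (_ : \bigcup_n B n = setT); last first.
    apply/seteqP; split => // w _; exists (Num.bound (tau 0%N w)) => //=.
    by rewrite /B /= ltW// archi_boundP.
  move=> /(measure_negligible measurableT) PT.
  move: (etrans (esym PT) (@probability_setT _ _ _ P)) => /eqP.
  by rewrite eq_sym onee_eq0.
have Bfin : P (B n) \is a fin_num by rewrite fin_num_measure.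
have b0 : 0 < fine (P (B n)).
  by rewrite fine_gt0// lt0e Bn measure_ge0/= -ge0_fin_numE.
set b := fine (P (B n)) in b0.
pose e := (expR (r * n%:R))^-1; have e0 : 0 < e by rewrite invr_gt0 expR_gt0.
have [C1 C10 hC] := hC1 e e0.
exists (C1 / b); first by rewrite divr_gt0.
have hC' := near_pinfty_scale (expR_gt0 (r * n%:R)) hC.
near=> x.
have x0 : 0 < x by near: x; exact: nbhs_pinfty_gt.
have : F (e * (expR (r * n%:R) * x)) <= C1 * F (expR (r * n%:R) * x) by near: x.
rewrite mulrA mulVf ?gt_eqF ?expR_gt0// mul1r => /le_trans; apply.
rewrite -mulrA ler_pM2l// ler_pdivlMl//.
rewrite -lee_fin fineK; last by rewrite fin_num_measure//; exact: measurable_above.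
rewrite prob_Z EFinM fineK// -(setIT (B n)) -integral_indic// muleC.
rewrite -ge0_integralZl//; last 2 first.
- by apply/measurable_EFinP; exact: measurable_indic.
- by rewrite lee_fin.
apply: ge0_le_integral => //.
- by move=> w _; rewrite mule_ge0// lee_fin.
- by apply: measurable_funeM; apply/measurable_EFinP; exact: measurable_indic.
move=> w _; rewrite -EFinM lee_fin indicE.
have [Bw|_] := boolP (w \in B n); last by rewrite mulr0.
rewrite mulr1; apply: F_ni; rewrite mulrC ler_pM2r// ler_expR ler_pM2l//.
by move: Bw; rewrite inE.
Unshelve. all: by end_near. Qed.

(** * The ruin event and its one-dimensional bounds *)

Let E x := [set w | ext_mem (dilate x A) (discounted_claims r X tau w)].

Let f i w : 'rV[R]_d := theta i w *: (X i w : 'rV[R]_d).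

Let f_ge0 w i : nonneg_vec (f i w).
Proof. by apply: nonneg_vecZ; [exact: ltW|exact: X_ge0]. Qed.

Let scale_radius_f i w : scale_radius A (f i w) = Z i w.
Proof. by rewrite scale_radiusZ// mulrC. Qed.

Let discounted_claimsE w : discounted_claims r X tau w =
  fun j => (\sum_(0 <= i <oo) (f i w 0 j)%:E)%E.
Proof.
by apply/funext => j; apply: eq_eseriesr => i _; rewrite mxE mulrC.
Qed.

Let lower_event x i : 0 < x -> [set w | x < Z i w] `<=` E x.
Proof.
move=> x0 w /=; rewrite -scale_radius_f scale_radius_gt// => fA.
rewrite /E /= discounted_claimsE; apply/ext_mem_series => //.
exists i.+1; rewrite big_ord_recr /= addrC.
have [_ incA _ _] := hA.
exact: (increasing_dilate x0 incA fA (nonneg_vec_sum _ (f_ge0 w))).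
Qed.

Let upper_event x : 0 < x ->
  E x `<=` \bigcup_m [set w | x < \sum_(0 <= i < m) Z i w].
Proof.
move=> x0 w; rewrite /E /= discounted_claimsE => /ext_mem_series.
move=> /(_ hA x0 (f_ge0 w))[n]; rewrite -scale_radius_gt//; last first.
  exact: (nonneg_vec_sum _ (f_ge0 w)).
move=> xS; exists n => //=; apply: (lt_le_trans xS).
apply: (le_trans (scale_radius_sum _ hA (f_ge0 w))).
by rewrite big_mkord; apply: ler_sum => i _; rewrite scale_radius_f.
Qed.

Let mE x : 0 < x -> measurable (E x).
Proof.
move=> x0; have [oA incA _ _] := hA.
apply: measurable_ext_mem.
- by apply: open_dilate => //; rewrite gt_eqF.
- exact: increasing_dilate.
move=> j; apply: ge0_emeasurable_sum => [k w _ _|k _].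
  by rewrite lee_fin mulr_ge0 ?X_ge0// expR_ge0.
apply/measurable_EFinP; apply: measurable_funM; last exact: mtheta.
apply: (@measurableT_comp _ _ _ _ _ _
  ((fun z : 'rV[R]_d => z 0 j) : borel_rV R d -> R)).
  apply: (measurability _ (RGenOInfty.measurableE R)) => // _ [_ [y ->] <-].
  rewrite setTI; apply: sub_sigma_algebra.
  apply: open_comp; first by move=> z _; exact: coord_continuous.
  exact: interval_open.
exact: measurable_funPT.
Qed.

(** The mean measure is the sum of the laws of the [tau i], all carried by the nonnegative
    half-line, and the integrand is [F (x * exp (r s))]; by [prob_Z] each summand integrates to the
    tail of [Z i]. *)
Let denominatorE x : 0 < x ->
  (\int[mean_measure tau]_(s in `[0%R, +oo[)
    P' [set w | dilate x A (expR (- (r * s)) *: (X0 w : 'rV[R]_d))] =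
  \sum_(0 <= i <oo) P [set w | (x < Z i w)%R])%E.
Proof.
move=> x0.
have PE s : P' [set w | dilate x A (expR (- (r * s)) *: (X0 w : 'rV[R]_d))] =
    (F (x * expR (r * s)))%:E.
  have mS : measurable
      ([set z | dilate x A (expR (- (r * s)) *: z)] : set (borel_rV R d)).
    apply: sub_sigma_algebra.
    rewrite (_ : [set z | _] = (fun z => expR (- (r * s)) *: z) @^-1` dilate x A)//.
    apply: open_comp; first by move=> z _; exact: scaler_continuous.
    by apply: open_dilate; rewrite ?gt_eqF//; case: hA.
  (* [X 0] takes the place of [X0] because it is nonnegative at every outcome, as [scale_radius_gt]
     requires. *)
  have := hXid 0 mS; rewrite /distribution /pushforward /= => <-.
  rewrite -(prob_Y 0); congr (P _); apply/seteqP; split => w /=.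
    rewrite -scale_radius_gt ?scale_radiusZ ?expR_gt0//; last first.
      by apply: nonneg_vecZ; rewrite ?expR_ge0.
    by rewrite mulrC above_Z.
  move=> h; rewrite -scale_radius_gt ?scale_radiusZ ?expR_gt0//; last first.
    by apply: nonneg_vecZ; rewrite ?expR_ge0.
  by rewrite mulrC above_Z.
under eq_integral do rewrite PE.
have mFs : measurable_fun [set: R] (fun s => (F (x * expR (r * s)))%:E).
  apply/measurable_EFinP; apply: nonincreasing_measurable => // u v uv.
  by apply: F_ni; rewrite ler_pM2l// ler_expR ler_pM2l.
rewrite ge0_integral_measure_series//;
  [|by move=> t _; rewrite lee_fin|exact: measurable_funTS].
apply: eq_eseriesr => i _; rewrite ge0_integral_pushforward//;
  [|exact: measurable_funTS|by move=> t _; rewrite lee_fin].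
rewrite prob_Z (_ : tau i @^-1` _ = setT)//.
by apply/seteqP; split => // w _ /=; rewrite in_itv/= tau_ge0.
Qed.

(** A single exponent [p], at least 1 and above the upper index, covers both cases in the definition
    of [q]. *)
Lemma discounted_claims_tail (p q1 q2 : R) :
  consistently_varying FA -> 1 <= p -> 0 < q1 -> 0 < q2 ->
  (q1%:E < lower_matuszewska FA)%E -> (0 < upper_matuszewska FA < p%:E)%E ->
  (\sum_(0 <= i <oo)
     poweR (maxe 'E_P[fun w => expR (- (q1 * r * tau i w))]
                 'E_P[fun w => expR (- (q2 * r * tau i w))]) p^-1 < +oo)%E ->
  quasi_asymp_indep P (fun i w => scale_radius A (X i w)) ->
  fine (P [set w | ext_mem (dilate x A) (discounted_claims r X tau w)]) /
  fine (\int[mean_measure tau]_(s in `[0%R, +oo[)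
          P' [set w | dilate x A (expR (- (r * s)) *: (X0 w : 'rV[R]_d))])%E
  @[x --> +oo] --> (1 : R).
Proof.
move=> hC p1 q10 q20 q1J pJ hsum hQAI; have F0 : forall x, 0 < F x := hC.1.
have p0 : 0 < p by exact: lt_le_trans p1.
have [v1 v11 /= low] := lower_matuszewska_near F0 q10 q1J.
have [v2 [K [v21 K0 Kv up]]] := upper_matuszewska_near F0 pJ.
have [M [_ HM]] : \forall x \near +oo, F (v1 * x) <= v1 `^ (- q1) * F x /\
    F x <= K * F (v2 * x).
  by near=> x; split; near: x.
pose D := Num.max 1 (M + 1).
have D0 : 0 < D by rewrite lt_max ltr01.
have D1 x : D <= x -> M < x.
  by rewrite ge_max => /andP[_]; apply: lt_le_trans; rewrite ltrDl.
have decay : forall s x, 1 <= s -> D <= x -> F (s * x) <= v1 `^ q1 * s `^ (- q1) * F x.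
  apply: (tail_power_decay F0 D0 F_ni v11 q10) => x Dx.
  by have [] := HM x (D1 _ Dx).
have grow x : D <= x -> F x <= K * F (v2 * x).
  by move=> Dx; have [] := HM x (D1 _ Dx).
have dominated e : 0 < e -> exists2 C, 0 < C &
    \forall x \near +oo, F (e * x) <= C * F x.
  move=> e0; have [C C0 HC] := tail_scale_bound D0 F_ni v21 K0 e0 grow.
  exists C => //; have : \forall x \near +oo, D <= x.
    by apply: nbhs_pinfty_ge; exact: num_real.
  by move=> /(near_pinfty_scale e0); apply: filterS => x /HC.
(* The moments depend only on the common law of the claims, so the constant found for index 0 serves
   every [i]. *)
have [B B0 HB] : exists2 B, 0 < B & forall i y, D <= y ->
    (\int[P]_w (trunc_pow p y (Y i w))%:E <= (B * F y)%:E)%E.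
  have [B B0 HB] := @trunc_moment_bound _ _ _ P (Y 0) F p v2 K D (mY 0) (Y_ge0 0)
    (ltW p0) (fun x => congr1 fine (prob_Y 0 x)) F0 D0 F_ni v21 K0 Kv grow.
  exists B; first exact: B0.
  move=> i y Dy; have := HB y Dy.
  have tr k : (\int[P]_w (trunc_pow p y (Y k w))%:E =
      \int[distribution P' X0]_z (trunc_pow p y (scale_radius A z))%:E)%E.
    have mz : measurable_fun [set: borel_rV R d]
        (fun z => (trunc_pow p y (scale_radius A z))%:E).
      apply/measurable_EFinP; apply: measurable_trunc_pow.
      exact: measurable_scale_radius.
    transitivity (\int[distribution P (X k)]_z
        (trunc_pow p y (scale_radius A z))%:E)%E.
      by rewrite ge0_integral_distribution// => z; rewrite lee_fin trunc_pow_ge0.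
    by apply: eq_measure_integral => S mS _; exact: hXid.
  by rewrite (tr 0) (tr i).
pose m i := (maxe 'E_P[fun w => expR (- (q1 * r * tau i w))]
                  'E_P[fun w => expR (- (q2 * r * tau i w))])%E.
have E0 q i : (0 <= 'E_P[fun w => expR (- (q * r * tau i w))])%E.
  by apply: expectation_ge0 => w; exact: expR_ge0.
have E1 q i : 0 < q -> ('E_P[fun w => expR (- (q * r * tau i w))] <= 1)%E.
  move=> q0; rewrite unlock; apply: (@le_trans _ _ (\int[P]_w (cst 1 w))%E).
    apply: ge0_le_integral => //.
    - apply/measurable_EFinP; apply: (measurableT_comp (@measurable_expR R)).
      by apply: measurableT_comp => //; exact: measurable_funM.
    - by move=> w _; rewrite lee_fin expR_le1 oppr_le0 !mulr_ge0// ltW.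
  by rewrite integral_cst// mul1e; exact: probability_le1.
have m0 i : (0 <= m i)%E by rewrite le_max E0.
have mfin i : m i \is a fin_num.
  by rewrite ge0_fin_numE// (le_lt_trans _ (ltry 1))// ge_max !E1.
have mE' i : m i = (fine (m i))%:E by rewrite fineK.
(* The summable geometric term makes [s i] positive at once, and [s i ^ p] still dominates [m i]. *)
pose s i := fine (m i) `^ p^-1 + 1 / (2 ^ i.+1)%:R : R.
have half0 i : 0 < 1 / (2 ^ i.+1)%:R :> R by rewrite divr_gt0// ltr0n expn_gt0.
have s0 i : 0 < s i by rewrite ltr_wpDl ?powR_ge0.
have s_sum : (\sum_(0 <= i <oo) (s i)%:E < +oo)%E.
  under eq_eseriesr do rewrite EFinD -poweR_EFin -mE'.
  rewrite nneseriesD//; last by move=> i _ _; exact: poweR_ge0.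
  rewrite lte_add_pinfty//.
  apply: (le_lt_trans (epsilon_trick0 xpredT ler01)); exact: ltry.
have BC0 : 0 < B * v1 `^ q1 by rewrite mulr_gt0// powR_gt0// (lt_trans _ v11).
have m_le_s i : fine (m i) <= s i `^ p.
  have -> : fine (m i) = (fine (m i) `^ p^-1) `^ p.
    by rewrite -powRrM mulVf ?gt_eqF// powRr1// fine_ge0.
  rewrite ge0_ler_powR ?(ltW p0) ?nnegrE ?powR_ge0 ?(ltW (s0 i))//.
  by rewrite lerDl ltW.
have moment i y : D <= y -> (\int[P]_w (trunc_pow p y (Z i w))%:E <=
    (B * v1 `^ q1 * s i `^ p * F y)%:E)%E.
  move=> Dy; apply: (le_trans (moment_Z D0 (ltW B0) (powR_ge0 _ _) HB decay i Dy)).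
  apply: (@le_trans _ _ ((B * v1 `^ q1 * F y)%:E * m i)%E).
    apply: lee_wpmul2l; first by rewrite lee_fin mulr_ge0// ltW.
    by rewrite le_max lexx.
  rewrite mE' -EFinM lee_fin mulrAC ler_pM2r// ler_pM2l//.
have [t t0 ht] := tail_estimates mZ Z_ge0 F0 s0 p1 BC0 D0 s_sum moment.
have near_D : \forall x \near +oo, D <= x.
  by apply: nbhs_pinfty_ge; exact: num_real.
have near_0 : \forall x \near +oo, 0 < x :> R.
  by apply: nbhs_pinfty_gt; exact: num_real.
have joint i j : i != j -> forall e, 0 < e ->
    \forall x \near +oo, fine (P [set w | x < Y i w /\ x < Y j w]) <= e * F x.
  (* Both tails in the denominator equal [F x], hence the half. *)
  move=> ij e e0; have e2 : 0 < e / 2 by rewrite divr_gt0.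
  have /cvgrPdist_le/(_ _ e2) := hQAI i j ij.
  apply: filterS => x; rewrite !tail_Y sub0r normrN => /ler_normlW.
  rewrite (ler_pdivrMr _ _ (addr_gt0 (F0 x) (F0 x))) => /le_trans; apply.
  by rewrite le_eqVlt; apply/orP; left; apply/eqP; field.
have consistent e : 0 < e -> exists2 b, 0 < b < 1 & \forall x \near +oo, forall i,
    fine (P [set w | b * x < Z i w]) <= (1 + e) * fine (P [set w | x < Z i w]).
  move=> e0; have [b b01 [N [_ HN]]] := consistently_varying_near hC e0.
  have : \forall x \near +oo, Num.max 1 (N + 1) <= x.
    by apply: nbhs_pinfty_ge; exact: num_real.
  move=> large; exists b => //; apply: filterS large => x Nx i.
  apply: (@prob_Z_consistent b e (Num.max 1 (N + 1))) => //.
  - by rewrite lt_max ltr01.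
  - exact: ltW.
  - move=> z; rewrite ge_max => /andP[_ Nz]; apply: HN.
    by apply: lt_le_trans Nz; rewrite ltrDl.
have first := first_tail F0 dominated.
apply: cvg_trans (@quasi_independent_series _ _ _ P Y Z F E t mY mZ Z_le_Y Z_ge0 F0
  joint consistent dominated first t0 _ _ _ _ _).
- by apply: near_eq_cvg; apply: filterS near_0 => x x0; rewrite denominatorE.
- by apply: filterS near_D => x Dx n; have [] := ht x n Dx.
- by apply: filterS near_D => x Dx n; have [] := ht x n Dx.
- by apply: filterS near_0 => x x0; exact: mE.
- by apply: filterS near_0 => x x0 i; exact: lower_event.
- by apply: filterS near_0 => x x0; exact: upper_event.
Unshelve. all: by end_near. Qed.

End risk_model.

(** * Reduction of the theorem to a single exponent *)

Theorem theorem3p2 (R : realType) (d : nat) (hd : (0 < d)%N)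
  (dOmega dOmega' : measure_display)
  (Omega : measurableType dOmega) (P : probability Omega R)
  (Omega' : measurableType dOmega') (P' : probability Omega' R)
  (A : set 'rV[R]_d) (hA : ruin_family A)
  (r : R) (hr : 0 < r)
  (* the generic claim, with distribution F, and the claims *)
  (X0 : {RV P' >-> borel_rV R d})
  (X : nat -> {RV P >-> borel_rV R d})
  (hF : P' [set w | nonneg_vec (X0 w)] = 1%E)
  (hX : forall i w, nonneg_vec (X i w) /\ (X i w : 'rV[R]_d) != 0)
  (hXid : forall i (B : set (borel_rV R d)), measurable B ->
    distribution P (X i) B = distribution P' X0 B)
  (* the arrival times *)
  (tau : nat -> {RV P >-> R})
  (htau0 : forall i w, 0 <= tau i w)
  (htau : forall i w, tau i w <= tau i.+1 w)
  (hm : forall t : R, 0 <= t -> (mean_number P tau t < +oo)%E)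
  (hindep : indep_seq P (fun i => X i) (fun i => tau i))
  (FA := distr_fun P' (fun w => scale_radius A (X0 w)))
  (Jplus := upper_matuszewska FA)
  (Jminus := lower_matuszewska FA)
  (hC : consistently_varying FA)
  (hPD : positively_decreasing FA)
  (hq : exists q1 q2 : R,
    [/\ 0 < q1, (q1%:E < Jminus)%E, (Jminus <= Jplus)%E, (Jplus < q2%:E)%E &
      let q := (0 < Jplus < 1)%E%:R + q2 * (1 <= Jplus)%E%:R in
      (\sum_(0 <= i <oo)
        poweR (maxe 'E_P[fun w => expR (- (q1 * r * tau i w))]
                    'E_P[fun w => expR (- (q2 * r * tau i w))]) q^-1
        < +oo)%E])
  (hQAI : quasi_asymp_indep P (fun i w => scale_radius A (X i w))) :
  fine (P [set w | ext_mem (dilate x A) (discounted_claims r X tau w)]) /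
  fine (\int[mean_measure tau]_(s in `[0%R, +oo[)
          P' [set w | dilate x A (expR (- (r * s)) *: (X0 w : 'rV[R]_d))])%E
  @[x --> +oo] --> (1 : R).
Proof.
have [q1 [q2 [q10 q1J JJ Jq2 /= hsum]]] := hq.
have q10E : (0 < q1%:E)%E by rewrite lte_fin.
have Jp0 : (0 < Jplus)%E by rewrite (lt_le_trans (lt_trans q10E q1J)).
have q20 : 0 < q2 by rewrite -lte_fin (lt_trans Jp0).
pose q := (0 < Jplus < 1)%E%:R + q2 * (1 <= Jplus)%E%:R : R.
(* Below 1 the upper index is covered by [q = 1]; otherwise [q = q2], which exceeds [Jplus] and
   therefore 1. *)
have [q1' Jq] : 1 <= q /\ (Jplus < q%:E)%E.
  rewrite /q Jp0 /=; have [J1|J1] := ltP Jplus 1%E.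
    by rewrite /= mulr0 addr0.
  rewrite /= mulr1 add0r; split=> //.
  by rewrite -lee_fin (le_trans J1)// ltW.
apply: (@discounted_claims_tail _ _ _ _ _ _ _ _ _ _ _ _ _
  hA hr _ hXid htau0 hindep q q1 q2) => //.
- by move=> i w; have [] := hX i w.
- by rewrite Jp0 Jq.
Qed.
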